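(* There exist absolute constants $C,c>0$ such that the following holds. Let $n\ge2$, $0<q<1$ and $\pi\sim\mu_{n,q}$. (i) If $0<q<1-\frac2n$ then for every integer $L\ge2$, $$\mathbb{P}(\mathrm{LDS}(\pi)\ge L)\le n^8\begin{cases}\left(\frac{C}{(1-q)L^2}\right)^L & L\le \frac{3}{1-q},\\ (C(1-q))^L q^{\frac{L(L-1)}{2}} & L>\frac{3}{1-q}.\end{cases}$$ Moreover, if $0<q<\frac12$ then for every integer $L\ge 2$, $\mathbb{P}(\mathrm{LDS}(\pi)\ge L)\le nC^Lq^{\frac{L(L-1)}{2}}$. (ii) For integer $L$, $$\mathbb{P}(\mathrm{LDS}(\pi)\ge L)\ge 1-\left(1-\left(\frac{c}{(1-q)L^2}\right)^L\right)^{\lfloor n(1-q)/4\rfloor}\quad\text{if } \frac{C}{\sqrt{1-q}}\le L\le\frac{1}{1-q}\text{ and }\frac12\le q\le 1-\frac4n,$$ and $$\mathbb{P}(\mathrm{LDS}(\pi)\ge L)\ge 1-\left(1-q^{\frac{L(L-1)}{2}}(1-q)^L\right)^{\lfloor n/L\rfloor}\quad\text{for any } L\ge 2.$$ (iii) Let $\frac12\le q\le 1-\frac4n$. For every integer $2\le L<\frac{c}{\sqrt{1-q}}$, $$\mathbb{P}(\mathrm{LDS}(\pi)<L)\le (C(1-q)L^2)^{n/L}.$$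
   Context: For $q>0$ and an integer $n\ge1$, the Mallows measure $\mu_{n,q}$ on $S_n$ is $\mu_{n,q}(\pi)=q^{\mathrm{inv}(\pi)}/Z_{n,q}$, where $\mathrm{inv}(\pi)$ is the number of pairs $i<j$ with $\pi(i)>\pi(j)$ and $Z_{n,q}$ is the normalizing constant. $\mathrm{LDS}(\pi)$ denotes the length of a longest decreasing subsequence of $\pi$, i.e. the maximal $m$ with indices $i_1<\dots<i_m$ such that $\pi(i_1)>\dots>\pi(i_m)$. *)

(* Defs.v *)
From HB Require Import structures.
From mathcomp Require Import all_boot all_order all_algebra all_fingroup.
From mathcomp Require Import reals exp Rstruct.
Set Implicit Arguments. Unset Strict Implicit. Unset Printing Implicit Defensive.
Import Order.TTheory GRing.Theory Num.Theory.
Local Open Scope ring_scope.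

Definition inv_count (n : nat) (s : 'S_n) : nat :=
  #|[set p : 'I_n * 'I_n | (p.1 < p.2)%N && (s p.2 < s p.1)%N]|.

Definition decr_on (n : nat) (s : 'S_n) (A : {set 'I_n}) : bool :=
  [forall i in A, forall j in A, (i < j)%N ==> (s j < s i)%N].

Definition LDS (n : nat) (s : 'S_n) : nat :=
  \max_(A : {set 'I_n} | decr_on s A) #|A|.

Definition mallows_Z (R : realType) (n : nat) (q : R) : R :=
  \sum_(s : 'S_n) q ^+ inv_count s.

Definition mallows (R : realType) (n : nat) (q : R) (s : 'S_n) : R :=
  q ^+ inv_count s / mallows_Z n q.

Definition mallows_prob (R : realType) (n : nat) (q : R) (E : pred 'S_n) : R :=
  \sum_(s : 'S_n | E s) mallows q s.

Arguments mallows_Z {R} n q.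
Arguments mallows {R} {n} q s.
Arguments mallows_prob {R} n q E.

(* Main.v *)
Require Import Defs.
From HB Require Import structures.
From mathcomp Require Import all_boot all_order all_algebra all_fingroup.
From mathcomp Require Import reals Rstruct sequences exp.
From mathcomp Require Import ring lra zify.
Import Order.TTheory GRing.Theory Num.Theory.
Set Implicit Arguments. Unset Strict Implicit. Unset Printing Implicit Defensive.
Local Open Scope ring_scope.

(* Write p = 1 - q and t = sqrt q.  Prepending a first value r to a permutation
   adds r inversions, so the Mallows measure is built by prepending independent
   truncated geometric values.

   (i) Let P(k,h) be the probability that some decreasing sequence of length k+1
   starts with the value h.  Prepending gives a recursive inequality for P(k,h)
   which does not depend on n once the common factor is cancelled, and
     p^(k+1) q^C(k+1,2) prod_{i<k} (1 - t^(h-i))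
       / ((1 + t^(h+1)) prod_{i<=k} (1 - t^i) prod_{i<=k+1} (1 - t^i))
   is a supersolution of it; summing over h < n gives the tail bounds.

   (ii) The patterns of two consecutive blocks of positions are independent
   Mallows permutations, so P(LDS < L) is submultiplicative in n.  Within a block
   of length of order 1/p the chain is grown greedily: in each of L successive
   runs of b = floor(1/(pL)) prepended values, one of them falls in a window of b
   values just above the current chain with probability of order p b^2.  For the
   second bound the block has length L and is completely reversed.

   (iii) If LDS < L in a block of length m of order 1/p, then by Erdos-Szekeres
   it has an increasing subsequence of length l >= m/L.  Rearranging the values at
   l given positions changes inv by at most 2lm, hence the weight by at most a
   factor C^l, so given positions are increasing with probability at most C^l/l!;
   take a union bound over positions and submultiplicativity over blocks. *)

(** * Inversions and the prepending of a first value *)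

Lemma inv_countE n (s : 'S_n) :
  inv_count s = (\sum_(i < n) \sum_(j < n) ((i < j) && (s j < s i)))%N.
Proof.
rewrite /inv_count -sum1_card pair_bigA /= big_mkcond /=.
by apply: eq_bigr => p _; rewrite inE; case: ifP.
Qed.

Lemma ltn_lift n (r : 'I_n.+1) (i j : 'I_n) : (lift r i < lift r j)%N = (i < j)%N.
Proof. by rewrite /= /bump; do 2!case: leqP => ? /=; lia. Qed.

Lemma ltn_lift_l n (r : 'I_n.+1) (i : 'I_n) : (lift r i < r)%N = (i < r)%N.
Proof. by rewrite /= /bump; case: leqP => ? /=; lia. Qed.

Lemma sum_ltn_ord n r : (r <= n)%N -> (\sum_(j < n) (j < r)%N = r)%N.
Proof.
move=> le; rewrite -(big_mkord xpredT (fun j => (j < r)%N : nat)) (big_cat_nat _ le) //=.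
rewrite big_nat (eq_bigr (fun=> 1%N)); last by move=> i /andP[_ ->].
rewrite -big_nat sum_nat_const_nat muln1 subn0 big_nat big1 ?addn0 //.
by move=> i /andP[]; rewrite leqNgt => /negbTE->.
Qed.

(** The new first entry [r] is inverted with exactly the [r] smaller values, and [lift r] preserves
    the order of the old ones. *)
Lemma inv_count_lift_perm n (r : 'I_n.+1) (s : 'S_n) :
  inv_count (lift_perm ord0 r s) = (r + inv_count s)%N.
Proof.
rewrite !inv_countE big_ord_recl; congr addn.
  rewrite big_ord_recl ltnn /= add0n lift_perm_id.
  under eq_bigr do rewrite lift_perm_lift ltn_lift_l.
  rewrite -[RHS](@sum_ltn_ord n); last by rewrite -ltnS.
  by rewrite [RHS](reindex_inj (@perm_inj _ s)).
apply: eq_bigr => i _; rewrite big_ord_recl /= add0n.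
by apply: eq_bigr => j _; rewrite !lift_perm_lift ltn_lift.
Qed.

Lemma lift_perm_bij n :
  bijective (fun p : 'I_n.+1 * 'S_n => lift_perm ord0 p.1 p.2).
Proof.
apply: inj_card_bij => [[r s] [r' s'] /= e|].
  have er : r = r' by move/permP/(_ ord0): e; rewrite !lift_perm_id.
  congr pair => //; apply/permP => i; move/permP/(_ (lift ord0 i)): e.
  by rewrite !lift_perm_lift er => /lift_inj.
by rewrite card_prod !card_Sn card_ord factS.
Qed.

(** * The Mallows measure and its recursion on the first value *)

Section Prob.
Variables (R : realType) (q : R).
Hypothesis q0 : 0 < q.

Lemma sum_lift_perm n (F : 'S_n.+1 -> R) :
  \sum_s F s = \sum_(r < n.+1) \sum_(s : 'S_n) F (lift_perm ord0 r s).
Proof.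
have bij := lift_perm_bij n.
by rewrite pair_bigA /= (reindex _ (onW_bij _ bij)).
Qed.

Lemma mallows_Z_gt0 n : 0 < mallows_Z n q.
Proof.
rewrite /mallows_Z (bigD1 1%g) //=; apply: ltr_pwDl; first exact: exprn_gt0.
by apply: sumr_ge0 => s _; apply/ltW/exprn_gt0.
Qed.

Lemma mallows_ge0 n (s : 'S_n) : 0 <= mallows q s.
Proof. by rewrite divr_ge0 ?exprn_ge0 // ltW ?mallows_Z_gt0. Qed.

Lemma mallows_probE n (E : pred 'S_n) :
  mallows_prob n q E = (\sum_s (E s)%:R * q ^+ inv_count s) / mallows_Z n q.
Proof.
rewrite /mallows_prob big_mkcond mulr_suml; apply: eq_bigr => s _.
by case: ifP; rewrite ?mul1r ?mul0r.
Qed.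

Lemma mallows_prob_ge0 n (E : pred 'S_n) : 0 <= mallows_prob n q E.
Proof. by apply: sumr_ge0 => s _; apply: mallows_ge0. Qed.

Lemma mallows_probT n (E : pred 'S_n) :
  (forall s, E s) -> mallows_prob n q E = 1.
Proof.
move=> ET; rewrite mallows_probE; under eq_bigr do rewrite ET mul1r.
by rewrite divff // gt_eqF // mallows_Z_gt0.
Qed.

Lemma mallows_prob_mono n (E F : pred 'S_n) :
  (forall s, E s -> F s) -> mallows_prob n q E <= mallows_prob n q F.
Proof.
move=> EF; rewrite /mallows_prob big_mkcond [leRHS]big_mkcond.
apply: ler_sum => s _; case: ifP => [/EF->//|_]; case: ifP => // _.
exact: mallows_ge0.
Qed.

Lemma mallows_prob_le1 n (E : pred 'S_n) : mallows_prob n q E <= 1.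
Proof.
by rewrite -(@mallows_probT n (fun=> true)) //; apply: mallows_prob_mono.
Qed.

Lemma mallows_prob_bigU n (I : Type) (r : seq I) (P : pred I)
    (E : pred 'S_n) (F : I -> pred 'S_n) :
  (forall s, E s -> has (fun i => P i && F i s) r) ->
  mallows_prob n q E <= \sum_(i <- r | P i) mallows_prob n q (F i).
Proof.
move=> EF; rewrite /mallows_prob; under [leRHS]eq_bigr do rewrite big_mkcond.
rewrite exchange_big big_mkcond; apply: ler_sum => s _ /=.
have pos i : 0 <= (if F i s then mallows q s else 0).
  by case: ifP => // _; apply: mallows_ge0.
case: ifP => [/EF|_]; last by apply: sumr_ge0.
elim: r {EF} => [//|i r IH] /=; rewrite big_cons.
case/orP => [/andP[-> ->]|/IH le]; first by rewrite lerDl sumr_ge0.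
by case: ifP => _ //; apply: le_trans le _; rewrite lerDr.
Qed.

Lemma mallows_probC n (E : pred 'S_n) :
  mallows_prob n q (fun s => ~~ E s) = 1 - mallows_prob n q E.
Proof.
rewrite -(@mallows_probT n (fun=> true)) // /mallows_prob.
by rewrite [X in _ = X - _](bigID E) /= addrAC subrr add0r.
Qed.

(** The q-integer, which normalizes the truncated geometric law of the first value. *)
Definition qnum n := \sum_(r < n) q ^+ r.

Lemma qnum_gt0 n : 0 < qnum n.+1.
Proof.
rewrite /qnum big_ord_recl; apply: ltr_pwDl; first exact: exprn_gt0.
by apply: sumr_ge0 => i _; apply/ltW/exprn_gt0.
Qed.

Lemma mallows_Z_rec n : mallows_Z n.+1 q = qnum n.+1 * mallows_Z n q.
Proof.
rewrite /mallows_Z sum_lift_perm mulr_suml; apply: eq_bigr => r _.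
by rewrite mulr_sumr; apply: eq_bigr => s _; rewrite inv_count_lift_perm exprD.
Qed.

(** Conditionally on the first value [r], which has weight [q ^+ r], the pattern of the other
    entries is again Mallows, by [inv_count_lift_perm]. *)
Lemma mallows_prob_rec n (E : pred 'S_n.+1) :
  mallows_prob n.+1 q E = (\sum_(r < n.+1)
    q ^+ r * mallows_prob n q (fun s => E (lift_perm ord0 r s))) / qnum n.+1.
Proof.
rewrite mallows_probE sum_lift_perm mallows_Z_rec invfM mulrA mulrAC.
congr (_ * _); rewrite mulr_suml; apply: eq_bigr => r _.
rewrite mallows_probE !mulr_suml mulr_sumr; apply: eq_bigr => s _.
by rewrite inv_count_lift_perm exprD; ring.
Qed.

Lemma qnumE n : (1 - q) * qnum n = 1 - q ^+ n.
Proof. by rewrite /qnum -opprB mulNr -subrX1 opprB. Qed.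

End Prob.

(** * Decreasing chains and their behaviour under prepending *)

Definition chain n (s : 'S_n) (k h : nat) : bool :=
  [exists A : {set 'I_n},
    [&& decr_on s A, #|A| == k & [forall i in A, (s i < h)%N]]].

(** The set [A] leaves out the top entry at [i0]: the whole chain has [k.+1] entries. *)
Definition chain_top n (s : 'S_n) (k h : nat) : bool :=
  [exists i0 : 'I_n, (s i0 == h :> nat) && [exists A : {set 'I_n},
    [&& decr_on s A, #|A| == k & [forall i in A, (i0 < i)%N && (s i < h)%N]]]].

Lemma decr_onP n (s : 'S_n) (A : {set 'I_n}) :
  reflect {in A &, forall i j : 'I_n, (i < j)%N -> (s j < s i)%N} (decr_on s A).
Proof.
apply: (iffP forall_inP) => [H i j iA jA|H i iA].
  by have /forall_inP/(_ j jA)/implyP := H i iA.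
by apply/forall_inP => j jA; apply/implyP; apply: H.
Qed.

Lemma decr_on_sub n (s : 'S_n) (A B : {set 'I_n}) :
  A \subset B -> decr_on s B -> decr_on s A.
Proof.
move=> /subsetP AB /decr_onP dB; apply/decr_onP => i j iA jA.
by apply: dB; apply: AB.
Qed.

Lemma exists_subset_card (T : finType) (A : {set T}) k :
  (k <= #|A|)%N -> exists2 B : {set T}, B \subset A & #|B| = k.
Proof.
case/card_geqP => l [ul <- lA]; exists [set:: l]; last by rewrite cardsE; apply/card_uniqP.
by apply/subsetP => x; rewrite inE; apply: lA.
Qed.

Lemma chainP n (s : 'S_n) k h :
  reflect (exists A : {set 'I_n}, [/\ decr_on s A, #|A| = k &
    {in A, forall i, (s i < h)%N}]) (chain s k h).
Proof.
apply: (iffP existsP) => -[A].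
  by case/and3P=> dA /eqP cA /forall_inP lA; exists A; split.
by case=> dA cA lA; exists A; rewrite dA cA eqxx; apply/forall_inP.
Qed.

Lemma chain_topP n (s : 'S_n) k h :
  reflect (exists (i0 : 'I_n) (A : {set 'I_n}), [/\ s i0 = h :> nat, decr_on s A,
    #|A| = k & {in A, forall i : 'I_n, (i0 < i)%N && (s i < h)%N}]) (chain_top s k h).
Proof.
apply: (iffP existsP) => -[i0].
  case/andP=> /eqP si0 /existsP[A /and3P[dA /eqP cA /forall_inP lA]].
  by exists i0, A; split.
case=> A [si0 dA cA lA]; exists i0; rewrite si0 eqxx; apply/existsP; exists A.
by rewrite dA cA eqxx; apply/forall_inP.
Qed.

Lemma card_preim_lift0 n (A : {set 'I_n.+1}) :
  #|A| = ((ord0 \in A) + #|lift ord0 @^-1: A|)%N.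
Proof.
rewrite -!sum1_card [LHS]big_mkcond [X in _ = (_ + X)%N]big_mkcond /= big_ord_recl.
by congr addn; apply: eq_bigr => i _; rewrite inE.
Qed.

Lemma decr_on_preim_lift n (s : 'S_n) (r : 'I_n.+1) (A : {set 'I_n.+1}) :
  decr_on (lift_perm ord0 r s) A -> decr_on s (lift ord0 @^-1: A).
Proof.
move=> /decr_onP dA; apply/decr_onP => i j; rewrite !inE => iA jA ij.
by move: (dA _ _ iA jA); rewrite !lift_perm_lift !ltn_lift; apply.
Qed.

Lemma decr_on_imset_lift n (s : 'S_n) (r : 'I_n.+1) (A : {set 'I_n}) :
  decr_on s A -> decr_on (lift_perm ord0 r s) (lift ord0 @: A).
Proof.
move=> /decr_onP dA; apply/decr_onP => i j /imsetP[i' iA ->] /imsetP[j' jA ->].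
by rewrite !lift_perm_lift !ltn_lift; apply: dA.
Qed.

Lemma chain_weaken n (s : 'S_n) k h h' : (h <= h')%N -> chain s k h -> chain s k h'.
Proof.
move=> hh /chainP[A [dA cA lA]]; apply/chainP; exists A; split=> // i /lA.
by move/leq_trans; apply.
Qed.

(** Whatever [r] is, [lift r] raises a value by at most one. *)
Lemma chain_lift n (s : 'S_n) r k h :
  chain s k h -> chain (lift_perm ord0 r s) k h.+1.
Proof.
move=> /chainP[A [dA cA lA]]; apply/chainP; exists (lift ord0 @: A); split.
- exact: decr_on_imset_lift.
- by rewrite card_imset //; apply: lift_inj.
- move=> _ /imsetP[i /lA lt ->]; rewrite lift_perm_lift /= /bump.
  by move: (nat_of_ord (s i)) lt => x; case: (r <= x)%N; lia.
Qed.

(** [lift r] fixes the values below [h <= r], so the new entry can be put on top of the chain. *)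
Lemma chain_cons n (s : 'S_n) (r : 'I_n.+1) k h :
  chain s k h -> (h <= r)%N -> chain (lift_perm ord0 r s) k.+1 r.+1.
Proof.
move=> /chainP[A [dA cA lA]] hr; apply/chainP.
exists (ord0 |: lift ord0 @: A); split.
- have /decr_onP dA' := decr_on_imset_lift r dA.
  apply/decr_onP => i j /setU1P[->|iA] /setU1P[->|jA] //; last exact: dA'.
  case/imsetP: jA => j' jA -> _; rewrite lift_perm_id lift_perm_lift ltn_lift_l.
  by apply: leq_trans hr; apply: lA.
- rewrite cardsU1 card_imset ?cA; last exact: lift_inj.
  by case: imsetP => // -[j _ /eqP]; rewrite (negbTE (neq_lift _ _)).
- move=> i /setU1P[->|/imsetP[j /lA lt ->]]; first by rewrite lift_perm_id.
  rewrite lift_perm_lift ltnS ltnW // ltn_lift_l.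
  exact: leq_trans lt hr.
Qed.

(** The leftmost entry of the chain carries its largest value. *)
Lemma chain_split n (s : 'S_n) k h :
  chain s k.+1 h -> exists2 h', (h' < h)%N & chain_top s k h'.
Proof.
move=> /chainP[A [dA cA lA]].
have /card_gt0P[a aA] : (0 < #|A|)%N by rewrite cA.
case: (arg_minnP (fun i : 'I_n => i : nat) aA) => i0 iA' min.
have iA : i0 \in A := iA'.
exists (s i0); first exact: lA.
apply/chain_topP; exists i0, (A :\ i0); split=> //.
- by apply: decr_on_sub dA; apply: subsetDl.
- by move: cA; rewrite (cardsD1 i0 A) iA => -[].
- move=> i /setD1P[ne jA]; have lt : (i0 < i)%N.
    by rewrite ltn_neqAle min // andbT; apply: contraNneq ne => e; apply/eqP/val_inj.
  by rewrite lt; move/decr_onP: dA; apply.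
Qed.

(** Either the new entry is the top, and the rest lies below [r], where [lift r] changes nothing; or
    the top was already present, with value [h] or [h.-1] according to its side of [r]. *)
Lemma chain_top_lift n (s : 'S_n) (r : 'I_n.+1) k h :
  chain_top (lift_perm ord0 r s) k h ->
  [|| (r == h :> nat) && chain s k h, (h < r)%N && chain_top s k h
    | (r < h)%N && chain_top s k h.-1].
Proof.
move=> /chain_topP[i0 [A [si0 dA cA lA]]].
have A0 : ord0 \notin A by apply/negP => /lA.
have cA' : #|lift ord0 @^-1: A| = k by rewrite -cA [RHS]card_preim_lift0 (negbTE A0).
have dA' := decr_on_preim_lift dA.
case: (unliftP ord0 i0) => [i0' e0|e0]; last first.
  have hr : h = r by rewrite -si0 e0 lift_perm_id.
  rewrite hr eqxx ltnn /= orbF; apply/chainP; exists (lift ord0 @^-1: A).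
  split=> // i; rewrite inE => /lA/andP[_].
  by rewrite lift_perm_lift hr ltn_lift_l.
move: si0; rewrite e0 lift_perm_lift => si0.
have ct : chain_top s k (s i0').
  apply/chain_topP; exists i0', (lift ord0 @^-1: A); split=> // i; rewrite inE => /lA.
  by rewrite e0 lift_perm_lift -si0 !ltn_lift.
case: (ltngtP r h) => rh; rewrite /= ?orbF.
- by rewrite (_ : h.-1 = s i0') //; move: rh; rewrite -si0 /= /bump; case: leqP => /=; lia.
- by rewrite (_ : h = s i0') //; move: rh; rewrite -si0 /= /bump; case: leqP => /=; lia.
- by move: si0; rewrite -rh /= /bump; case: leqP => /=; lia.
Qed.

Lemma leq_LDS n (s : 'S_n) (A : {set 'I_n}) : decr_on s A -> (#|A| <= LDS s)%N.
Proof. exact: (@leq_bigmax_cond _ _ (fun A : {set 'I_n} => #|A|)). Qed.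

Lemma LDS_witness n (s : 'S_n) k :
  (k <= LDS s)%N -> exists2 A : {set 'I_n}, decr_on s A & #|A| = k.
Proof.
have ex : exists2 A : {set 'I_n}, decr_on s A & #|A| = LDS s.
  have [|A dA e] := @eq_bigmax_cond _ [pred A | decr_on s A] (fun A : {set 'I_n} => #|A|).
    by apply/card_gt0P; exists set0; apply/decr_onP => i j; rewrite inE.
  by exists A; rewrite ?/LDS ?e.
case: ex => A dA <- kA.
have [B BA cB] := exists_subset_card kA.
by exists B => //; apply: decr_on_sub dA.
Qed.

Lemma chain_LDS n (s : 'S_n) k h : chain s k h -> (k <= LDS s)%N.
Proof. by move=> /chainP[A [dA <- _]]; apply: leq_LDS. Qed.

Lemma LDS_chain n (s : 'S_n) k : (k <= LDS s)%N -> chain s k n.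
Proof.
by move=> /LDS_witness[A dA cA]; apply/chainP; exists A; split=> // i _.
Qed.

(** * Products in base [t] and the upper tail bound *)

Section FallingQ.
Variables (R : realType) (t : R).
Hypothesis t01 : 0 < t < 1.

(** A falling factorial in base [t]. Truncated subtraction makes the factor at [i = h] zero, so the
    product vanishes for [h < j]. *)
Definition qfall (h j : nat) : R := \prod_(i < j) (1 - t ^+ (h - i)).

Definition qpoch (k : nat) : R := \prod_(i < k) (1 - t ^+ i.+1).

Lemma expt_ge0 k : 0 <= t ^+ k.
Proof. by case/andP: t01 => t0 _; rewrite exprn_ge0 ?ltW. Qed.

Lemma expt_le1 k : t ^+ k <= 1.
Proof. by case/andP: t01 => t0 t1; rewrite exprn_ile1 ?ltW. Qed.

Lemma exptS_lt1 k : t ^+ k.+1 < 1.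
Proof. by case/andP: t01 => t0 t1; rewrite exprn_ilt1 ?ltW. Qed.

Lemma qfall_ge0 h j : 0 <= qfall h j.
Proof. by apply: prodr_ge0 => i _; rewrite subr_ge0 expt_le1. Qed.

Lemma qfall_le1 h j : qfall h j <= 1.
Proof.
apply: prodr_ile1 => i _; rewrite subr_ge0 expt_le1 /=.
by rewrite lerBlDr lerDl expt_ge0.
Qed.

Lemma qfallSS h j : qfall h.+1 j.+1 = (1 - t ^+ h.+1) * qfall h j.
Proof. by rewrite /qfall big_ord_recl subn0; congr (_ * _); apply: eq_bigr. Qed.

Lemma qfallS h j : qfall h j.+1 = qfall h j * (1 - t ^+ (h - j)).
Proof. by rewrite /qfall big_ord_recr. Qed.

Lemma qfall_small h j : (h < j)%N -> qfall h j = 0.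
Proof.
by move=> hj; rewrite /qfall (bigD1 (Ordinal hj)) //= subnn subrr mul0r.
Qed.

(** The base [t] analogue of the difference rule for falling factorials. *)
Lemma qfall_diff h j :
  t ^+ j * (qfall h.+1 j.+1 - qfall h j.+1) = qfall h j * t ^+ h * (1 - t ^+ j.+1).
Proof.
rewrite qfallSS qfallS; case: (ltnP h j) => hj.
  by rewrite qfall_small //; ring.
have eh : t ^+ h = t ^+ (h - j) * t ^+ j by rewrite -exprD subnK.
by rewrite !exprS eh; ring.
Qed.

(** Telescoping of [qfall_diff]: the base [t] form of the hockey-stick identity. *)
Lemma qfall_sum h j :
  (1 - t ^+ j.+1) * (\sum_(h' < h) t ^+ h' * qfall h' j) = t ^+ j * qfall h j.+1.
Proof.
elim: h => [|h IH]; first by rewrite big_ord0 qfall_small // !mulr0.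
rewrite big_ord_recr /= mulrDr IH.
have := qfall_diff h j; rewrite mulrBr => /eqP; rewrite subr_eq => /eqP->; ring.
Qed.

Lemma qpochS k : qpoch k.+1 = qpoch k * (1 - t ^+ k.+1).
Proof. by rewrite /qpoch big_ord_recr. Qed.

Lemma qpoch_gt0 k : 0 < qpoch k.
Proof. by apply: prodr_gt0 => i _; rewrite subr_gt0 exptS_lt1. Qed.

Variable q : R.
Hypothesis qE : q = t ^+ 2.

Definition chain_coef k : R :=
  (1 - q) ^+ k.+1 * q ^+ 'C(k.+1, 2) / (qpoch k * qpoch k.+1).

(** The denominator is the second factor of [1 - q ^+ h.+1 = (1 - t ^+ h.+1) * (1 + t ^+ h.+1)], so
    that multiplying by this number leaves exactly a longer falling factorial, as in
    [chain_bound_mul]. *)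
Definition chain_bound k h : R := chain_coef k * qfall h k / (1 + t ^+ h.+1).

Lemma subq_gt0 : 0 < 1 - q.
Proof. by rewrite subr_gt0 qE exptS_lt1. Qed.

Lemma chain_coef_ge0 k : 0 <= chain_coef k.
Proof.
have q0 : 0 <= q by rewrite qE expt_ge0.
have D0 j : 0 <= qpoch j by rewrite ltW ?qpoch_gt0.
have p0 : 0 <= 1 - q by rewrite ltW ?subq_gt0.
by apply: divr_ge0; apply: mulr_ge0; rewrite ?exprn_ge0.
Qed.

Lemma addt_gt0 k : 0 < 1 + t ^+ k.
Proof. by apply: ltr_pwDl; rewrite ?expt_ge0. Qed.

Lemma chain_bound_ge0 k h : 0 <= chain_bound k h.
Proof.
apply: divr_ge0; last by rewrite ltW ?addt_gt0.
by rewrite mulr_ge0 ?chain_coef_ge0 ?qfall_ge0.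
Qed.

Lemma chain_bound_le k h : chain_bound k h <= chain_coef k * qfall h k.
Proof.
rewrite ler_pdivrMr ?addt_gt0 //; apply: ler_peMr.
  by rewrite mulr_ge0 ?chain_coef_ge0 ?qfall_ge0.
by rewrite lerDl expt_ge0.
Qed.

(** For [k = 0] the bound equals [(1 + t) / (1 + t ^+ h.+1)]. *)
Lemma chain_bound0 h : 1 <= chain_bound 0 h.
Proof.
have [t0 t1] := andP t01.
rewrite /chain_bound /chain_coef /qfall /qpoch big_ord0 big_ord_recl !big_ord0.
rewrite ler_pdivlMr ?addt_gt0 // mul1r !expr1 /= expr0 !mulr1 mul1r.
rewrite (_ : (1 - q) / (1 - t) = 1 + t); last first.
  by rewrite qE; field; rewrite subr_eq0 eq_sym lt_eqF.
by rewrite lerD2l exprS ler_piMr ?expt_le1 // ltW.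
Qed.

Lemma chain_coefS k : chain_coef k.+1 * ((1 - t ^+ k.+1) * (1 - t ^+ k.+2)) =
  chain_coef k * (1 - q) * q ^+ k.+1.
Proof.
have D0 j : qpoch j != 0 by rewrite gt_eqF // qpoch_gt0.
have := D0 k.+2; have := D0 k.+1; have := D0 k.
rewrite /chain_coef [qpoch k.+2]qpochS [qpoch k.+1]qpochS !mulf_eq0 !negb_or.
move=> d0 /andP[_ d1] /andP[_ d2].
have e : 'C(k.+2, 2) = (k.+1 + 'C(k.+1, 2))%N by rewrite binS bin1 addnC.
by rewrite e exprD (exprS _ k.+1); field; rewrite d0 d1 d2.
Qed.

Lemma chain_bound_mul k h :
  (1 - q ^+ h.+1) * chain_bound k h = chain_coef k * qfall h.+1 k.+1.
Proof.
rewrite qfallSS /chain_bound qE -exprM mulnC exprM.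
by field; rewrite gt_eqF // addt_gt0.
Qed.

Lemma chain_bound_mul_pred k h :
  (1 - q ^+ h) * chain_bound k h.-1 = chain_coef k * qfall h k.+1.
Proof.
case: h => [|h]; last exact: chain_bound_mul.
by rewrite expr0 subrr mul0r qfall_small // mulr0.
Qed.

(* [chain_bound] is a supersolution of the recursion satisfied by the
   probabilities of [chain_top]; the size of the permutation cancels out. *)
Lemma chain_bound_super k h :
  (1 - q) * (q ^+ h * \sum_(h' < h) chain_bound k h')
    + (1 - q ^+ h) * chain_bound k.+1 h.-1 <= (1 - q ^+ h.+1) * chain_bound k.+1 h.
Proof.
have [t0 t1] := andP t01.
have T j : 0 < 1 - t ^+ j.+1 by rewrite subr_gt0 exptS_lt1.
rewrite chain_bound_mul chain_bound_mul_pred -lerBrDr -mulrBr.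
(* As [h' < h], [q ^+ h = t ^+ (2 * h) <= t ^+ h.+1 * t ^+ h'], and the weight [t ^+ h'] is the one
   that [qfall_sum] can sum. This and [chain_bound_le] are the only losses. *)
have le1 : q ^+ h * \sum_(h' < h) chain_bound k h' <=
    t ^+ h.+1 * (chain_coef k * \sum_(h' < h) t ^+ h' * qfall h' k).
  rewrite !mulr_sumr; apply: ler_sum => h' _.
  apply: le_trans (_ : q ^+ h * (chain_coef k * qfall h' k) <= _).
    by rewrite ler_wpM2l ?chain_bound_le // exprn_ge0 // qE expt_ge0.
  rewrite (_ : t ^+ h.+1 * (chain_coef k * (t ^+ h' * qfall h' k)) =
    (t ^+ h.+1 * t ^+ h') * (chain_coef k * qfall h' k)); last by ring.
  rewrite ler_wpM2r //.
    by rewrite mulr_ge0 ?chain_coef_ge0 ?qfall_ge0.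
  rewrite qE -exprM -exprD; apply: ler_wiXn2l; rewrite ?ltW //.
  by have := ltn_ord h'; lia.
apply: le_trans (_ : (1 - q) *
   (t ^+ h.+1 * (chain_coef k * \sum_(h' < h) t ^+ h' * qfall h' k)) <= _).
  by rewrite ler_wpM2l // ltW // subq_gt0.
rewrite le_eqVlt; apply/orP; left; apply/eqP.
have s := qfall_sum h k; have d := qfall_diff h k.+1; have c := chain_coefS k.
(* What remains is an identity; the two factors multiplied in here bring its sides into the form of
   [qfall_sum] and [qfall_diff]. *)
apply: (mulfI (lt0r_neq0 (T k))).
apply: (mulfI (lt0r_neq0 (exprn_gt0 k.+1 t0))).
transitivity (t ^+ k.+1 * ((1 - q) * (t ^+ h.+1 * (chain_coef k *
    ((1 - t ^+ k.+1) * (\sum_(h' < h) t ^+ h' * qfall h' k)))))); first by ring.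
rewrite s.
transitivity (chain_coef k.+1 * (1 - t ^+ k.+1) *
  (t ^+ k.+1 * (qfall h.+1 k.+2 - qfall h k.+2))); last by ring.
rewrite d.
transitivity (chain_coef k.+1 * ((1 - t ^+ k.+1) * (1 - t ^+ k.+2)) *
   (qfall h k.+1 * t ^+ h)); last by ring.
rewrite c qE -exprM mulnC exprM !exprS; ring.
Qed.

(** Induction on [n], splitting by the first value [r]: [r = h] leaves a shorter chain below [h],
    any other [r] leaves a chain with top [h.-1] or [h]. After multiplication by [1 - q] the terms
    in [qnum q n.+1] cancel, and [chain_bound_super] remains. *)
Lemma chain_top_prob_le n k h :
  mallows_prob n q (fun s => chain_top s k h) <= chain_bound k h.
Proof.
have [t0 t1] := andP t01.
have q0 : 0 < q by rewrite qE exprn_gt0.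
elim: n k h => [|n IH] k h.
  rewrite /mallows_prob big_pred0 ?chain_bound_ge0 // => s.
  by apply/chain_topP => -[[]].
case: k => [|k].
  exact: le_trans (mallows_prob_le1 q0 _) (chain_bound0 h).
case: (leqP h n) => hn; last first.
  rewrite /mallows_prob big_pred0 ?chain_bound_ge0 // => s.
  apply/chain_topP => -[i0 [A [e _ _ _]]].
  by have := ltn_ord (s i0); rewrite e; lia.
rewrite mallows_prob_rec // ler_pdivrMr ?qnum_gt0 // mulrC.
set a := \sum_(h' < h) chain_bound k h'.
pose F r := q ^+ r * (if (r < h)%N then chain_bound k.+1 h.-1
   else if (h < r)%N then chain_bound k.+1 h else a).
apply: le_trans (_ : \sum_(r < n.+1) F r <= _).
  apply: ler_sum => r _; rewrite ler_wpM2l ?exprn_ge0 ?(ltW q0) //.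
  case: (ltngtP r h) => rh.
  - apply: le_trans _ (IH k.+1 h.-1); apply: mallows_prob_mono => // s.
    by move/chain_top_lift; case: (ltngtP r h) rh.
  - apply: le_trans _ (IH k.+1 h); apply: mallows_prob_mono => // s.
    by move/chain_top_lift; case: (ltngtP r h) rh => //= _ _; rewrite orbF.
  - apply: le_trans (_ : \sum_(h' < h) mallows_prob n q (fun s => chain_top s k h') <= _);
      last by apply: ler_sum => h' _; apply: IH.
    apply: mallows_prob_bigU => // s /chain_top_lift; rewrite rh eqxx ltnn /= orbF.
    case/chain_split => h' lt ct; apply/hasP.
    by exists (Ordinal lt); rewrite ?mem_index_enum.
rewrite -(big_mkord xpredT F) (@big_cat_nat _ _ _ h) ?(leqW hn) //= (@big_ltn _ _ _ h) //.
have e0 : F h = q ^+ h * a by rewrite /F ltnn.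
have e1 : \sum_(0 <= r < h) F r = qnum q h * chain_bound k.+1 h.-1.
  rewrite /qnum mulr_suml -(big_mkord xpredT (fun r => q ^+ r * chain_bound k.+1 h.-1)).
  by apply: eq_big_nat => r; rewrite /F => /andP[_ ->].
have e2 : \sum_(h.+1 <= r < n.+1) F r =
    (qnum q n.+1 - qnum q h.+1) * chain_bound k.+1 h.
  rewrite /qnum -!(big_mkord xpredT (fun r => q ^+ r)).
  rewrite [X in X - _](@big_cat_nat _ _ _ h.+1) //= addrAC subrr add0r mulr_suml.
  apply: eq_big_nat => r /andP[hr _]; rewrite /F hr.
  by rewrite ltnNge ltnW.
rewrite e0 e1 e2 -(ler_pM2l subq_gt0).
have := chain_bound_super k h; rewrite -/a -!qnumE //.
set x := chain_bound _ _; set y := chain_bound _ _; set u := qnum q h; set v := qnum q h.+1.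
move=> H; rewrite -subr_ge0; move: H; rewrite -(subr_ge0 (_ + _)) => H; apply: le_trans H _.
rewrite le_eqVlt; apply/orP; left; apply/eqP; ring.
Qed.

(** Union bound over the top value of a chain of length [k.+1]. *)
Lemma LDS_prob_le n k :
  mallows_prob n q (fun s => (k.+1 <= LDS s)%N) <= n%:R * chain_coef k.
Proof.
have [t0 t1] := andP t01.
have q0 : 0 < q by rewrite qE exprn_gt0.
apply: le_trans (_ : \sum_(h < n) chain_bound k h <= _).
  apply: le_trans (_ : \sum_(h < n) mallows_prob n q (fun s => chain_top s k h) <= _);
    last by apply: ler_sum => h _; apply: chain_top_prob_le.
  apply: mallows_prob_bigU => // s /LDS_chain/chain_split[h lt ct].
  by apply/hasP; exists (Ordinal lt); rewrite ?mem_index_enum.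
apply: le_trans (_ : \sum_(h < n) chain_coef k <= _).
  apply: ler_sum => h _; apply: le_trans (chain_bound_le _ _) _.
  by rewrite ler_piMr ?chain_coef_ge0 ?qfall_le1.
by rewrite sumr_const card_ord mulr_natl.
Qed.

Lemma chain_coef_le k : chain_coef k <=
  (1 - q) ^+ k.+1 * q ^+ 'C(k.+1, 2) / qpoch k.+1 ^+ 2.
Proof.
rewrite /chain_coef ler_wpM2l //.
  by rewrite mulr_ge0 // exprn_ge0 ?(ltW subq_gt0) // qE expt_ge0.
rewrite lef_pV2 ?posrE ?mulr_gt0 ?qpoch_gt0 // expr2 ler_wpM2r ?(ltW (qpoch_gt0 _)) //.
by rewrite qpochS ler_piMr ?(ltW (qpoch_gt0 _)) // lerBlDr lerDl expt_ge0.
Qed.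

End FallingQ.

(** * Patterns of a permutation along given positions *)

Section Pattern.
Variables (N m : nat) (f : 'I_m -> 'I_N).
Hypothesis f_inj : injective f.

Lemma rank_ltn (p : 'S_N) (i : 'I_m) :
  (#|[set j | (p (f j) < p (f i))%N]| < m)%N.
Proof.
rewrite -[ltnRHS]card_ord -cardsT; apply/proper_card/properP; split=> //.
by exists i; rewrite !inE ?ltnn.
Qed.

Definition rank (p : 'S_N) (i : 'I_m) : 'I_m := Ordinal (rank_ltn p i).

Lemma ltn_rank p i j : (rank p i < rank p j)%N = (p (f i) < p (f j))%N.
Proof.
apply/idP/idP => [|lt]; last first.
  apply/proper_card/properP; split; last by exists i; rewrite !inE ?ltnn.
  by apply/subsetP => k; rewrite !inE => /ltn_trans; apply.
apply: contraTT; rewrite -!leqNgt => le; apply/subset_leq_card/subsetP => k.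
by rewrite !inE => /leq_trans; apply.
Qed.

Lemma rank_inj p : injective (rank p).
Proof.
move=> i j e; apply/f_inj/(@perm_inj _ p)/val_inj/eqP.
have := ltn_rank p i j; have := ltn_rank p j i; rewrite e ltnn.
by case: ltngtP.
Qed.

Definition pattern p : 'S_m := perm (@rank_inj p).

Lemma ltn_pattern p i j : (pattern p i < pattern p j)%N = (p (f i) < p (f j))%N.
Proof. by rewrite !permE ltn_rank. Qed.

(** In [r * p] the permutation [r] acts first, hence on positions; it moves the chosen ones by [a],
    so the ranks are only relabelled. *)
Lemma pattern_mul (a : 'S_m) (r p : 'S_N) :
  (forall i, r (f i) = f (a i)) -> pattern (r * p)%g = (a * pattern p)%g.
Proof.
move=> ra; apply/permP => i; rewrite permM !permE; apply: val_inj => /=.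
rewrite -[RHS](card_preimset _ (@perm_inj _ a)); apply: eq_card => j.
by rewrite !inE !permM !ra.
Qed.

Lemma LDS_pattern p : {homo f : i j / (i < j)%N} -> (LDS (pattern p) <= LDS p)%N.
Proof.
move=> fm; have [A /decr_onP dA <-] := LDS_witness (leqnn (LDS (pattern p))).
rewrite -(card_imset _ f_inj); apply: leq_LDS; apply/decr_onP => i j.
move=> /imsetP[i' iA ->] /imsetP[j' jA ->] lt; rewrite -ltn_pattern.
apply: dA => //; case: ltngtP => // [/fm|/val_inj e]; first by case: ltngtP lt.
by move: lt; rewrite e ltnn.
Qed.

End Pattern.

(** * Independence of consecutive blocks *)

Section Blocks.
Variables m n : nat.

Definition block_fun (a : 'S_m) (b : 'S_n) (x : 'I_(m + n)) : 'I_(m + n) :=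
  match split x with inl i => lshift n (a i) | inr j => rshift m (b j) end.

Lemma block_fun_inj a b : injective (block_fun a b).
Proof.
move=> x y; rewrite /block_fun.
case: (split_ordP x) => i ->; case: (split_ordP y) => j -> e.
- by congr lshift; apply/(@perm_inj _ a)/(@lshift_inj _ n).
- by move/eqP: e; rewrite eq_lrshift.
- by move/eqP: e; rewrite eq_rlshift.
- by congr rshift; apply/(@perm_inj _ b)/(@rshift_inj m).
Qed.

Definition block_perm a b : 'S_(m + n) := perm (@block_fun_inj a b).

Lemma block_perm_lshift a b i : block_perm a b (lshift n i) = lshift n (a i).
Proof. by rewrite permE /block_fun (unsplitK (inl _ i)). Qed.

Lemma block_perm_rshift a b j : block_perm a b (rshift m j) = rshift m (b j).
Proof. by rewrite permE /block_fun (unsplitK (inr _ j)). Qed.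

Definition patl (p : 'S_(m + n)) : 'S_m := pattern (@lshift_inj m n) p.
Definition patr (p : 'S_(m + n)) : 'S_n := pattern (@rshift_inj m n) p.

Definition cross_inv (p : 'S_(m + n)) : nat :=
  (\sum_(i < m) \sum_(j < n) (p (rshift m j) < p (lshift n i)))%N.

Lemma inv_count_blocks p :
  inv_count p = (cross_inv p + (inv_count (patl p) + inv_count (patr p)))%N.
Proof.
rewrite !inv_countE big_split_ord /=.
have -> : (\sum_(i < m) \sum_(j < m + n) ((lshift n i < j) && (p j < p (lshift n i)))
    = \sum_(i < m) \sum_(j < m) ((i < j) && (patl p j < patl p i)) + cross_inv p)%N.
  rewrite /cross_inv -big_split; apply: eq_bigr => i _ /=; rewrite big_split_ord /=.
  congr addn; apply: eq_bigr => j _; first by rewrite ltn_pattern.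
  by rewrite /= (leq_trans (ltn_ord i)) ?leq_addr.
have -> : (\sum_(i < n) \sum_(j < m + n) ((rshift m i < j) && (p j < p (rshift m i)))
    = \sum_(i < n) \sum_(j < n) ((i < j) && (patr p j < patr p i)))%N.
  apply: eq_bigr => i _ /=; rewrite big_split_ord /= big1 ?add0n => [|j _].
    by apply: eq_bigr => j _; rewrite ltn_pattern ltn_add2l.
  by rewrite /= ltnNge ltnW // (leq_trans (ltn_ord j)) ?leq_addr.
by rewrite -addnA addnCA.
Qed.

(** Each block keeps its set of values, and only these sets matter for inversions between the
    blocks. *)
Lemma cross_inv_block a b p : cross_inv (block_perm a b * p)%g = cross_inv p.
Proof.
rewrite /cross_inv [RHS](reindex_inj (@perm_inj _ a)); apply: eq_bigr => i _.
rewrite [RHS](reindex_inj (@perm_inj _ b)); apply: eq_bigr => j _.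
by rewrite !permM block_perm_lshift block_perm_rshift.
Qed.

Lemma patl_block a b p : patl (block_perm a b * p)%g = (a * patl p)%g.
Proof. by apply: pattern_mul => i; rewrite block_perm_lshift. Qed.

Lemma patr_block a b p : patr (block_perm a b * p)%g = (b * patr p)%g.
Proof. by apply: pattern_mul => i; rewrite block_perm_rshift. Qed.

Variables (R : realType) (q : R).

(* Average over the action of S_m x S_n on positions, which fixes [cross_inv]. *)
Lemma sum_blocks (F : 'S_m -> R) (G : 'S_n -> R) :
  (m`! * n`!)%:R * (\sum_p q ^+ cross_inv p * (F (patl p) * G (patr p))) =
  (\sum_p q ^+ cross_inv p) * ((\sum_a F a) * (\sum_b G b)).
Proof.
set S := \sum_p _.
have inv a b : S = \sum_p q ^+ cross_inv p * (F (a * patl p)%g * G (b * patr p)%g).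
  rewrite /S (reindex_inj (mulgI (block_perm a b))); apply: eq_bigr => p _.
  by rewrite cross_inv_block patl_block patr_block.
transitivity (\sum_(a : 'S_m) \sum_(b : 'S_n) S).
  by rewrite !sumr_const !card_Sn -mulrnA mulr_natl mulnC.
under eq_bigr => a _ do under eq_bigr => b _ do rewrite (inv a b).
under eq_bigr do rewrite exchange_big /=.
rewrite exchange_big mulr_suml; apply: eq_bigr => p _ /=.
rewrite [\sum_a F a](reindex_inj (mulIg (patl p))) [\sum_b G b](reindex_inj (mulIg (patr p))).
by rewrite big_distrlr /= mulr_sumr; apply: eq_bigr => a _; rewrite mulr_sumr.
Qed.

Hypothesis q0 : 0 < q.

(** The weight is a cross term times the weights of the two patterns. The sum of [q ^+ cross_inv p]
    is never computed: it cancels against the same sum in the normalization, obtained from the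
    events that are always true. *)
Lemma mallows_prob_blocks (E : pred 'S_m) (F : pred 'S_n) :
  mallows_prob (m + n) q (fun p => E (patl p) && F (patr p)) =
  mallows_prob m q E * mallows_prob n q F.
Proof.
pose w k (P : pred 'S_k) (s : 'S_k) : R := (P s)%:R * q ^+ inv_count s.
have W (P : pred 'S_m) (Q : pred 'S_n) :
    (m`! * n`!)%:R * (\sum_p (P (patl p) && Q (patr p))%:R * q ^+ inv_count p) =
    (\sum_p q ^+ cross_inv p) * ((\sum_a w _ P a) * (\sum_b w _ Q b)).
  rewrite -sum_blocks; congr (_ * _); apply: eq_bigr => p _.
  by rewrite inv_count_blocks !exprD /w -mulnb natrM; ring.
have f0 : (m`! * n`!)%:R != 0 :> R by rewrite pnatr_eq0 -lt0n muln_gt0 !fact_gt0.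
have Z0 k : mallows_Z k q != 0 by rewrite gt_eqF // mallows_Z_gt0.
have wT k : \sum_a w k (fun=> true) a = mallows_Z k q.
  by apply: eq_bigr => s _; rewrite /w mul1r.
have eZ : (m`! * n`!)%:R * mallows_Z (m + n) q =
    (\sum_p q ^+ cross_inv p) * (mallows_Z m q * mallows_Z n q).
  by rewrite -!wT -W.
have := W E F; rewrite !mallows_probE -/(w m E) -/(w n F).
set X := \sum_(p : 'S_(m + n)) _ => eX.
set U := \sum_s _; set V := \sum_s _; rewrite -/U -/V in eX.
rewrite mulf_div; apply/eqP; rewrite eqr_div ?mulf_neq0 //; apply/eqP.
apply: (mulfI f0); rewrite [LHS]mulrA eX [RHS]mulrCA eZ.
move: eX; move: U V (\sum_p q ^+ cross_inv p) => U V K _; ring.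
Qed.

Lemma LDS_prob_submul L :
  mallows_prob (m + n) q (fun s => (LDS s < L)%N) <=
  mallows_prob m q (fun s => (LDS s < L)%N) * mallows_prob n q (fun s => (LDS s < L)%N).
Proof.
rewrite -mallows_prob_blocks; apply: mallows_prob_mono => // p lt.
by rewrite !(leq_ltn_trans _ lt) // LDS_pattern // => i j /=; rewrite ltn_add2l.
Qed.

End Blocks.

(** Splits off [k] blocks of length [m]; the leftover positions are bounded by probability 1. *)
Lemma LDS_prob_pow (R : realType) (q : R) (m n k L : nat) : 0 < q -> (k * m <= n)%N ->
  mallows_prob n q (fun s => (LDS s < L)%N) <=
  mallows_prob m q (fun s => (LDS s < L)%N) ^+ k.
Proof.
move=> q0; elim: k n => [|k IH] n; first by rewrite expr0 mallows_prob_le1.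
rewrite mulSn => le; have mn : (m <= n)%N by apply: leq_trans le; apply: leq_addr.
rewrite -(subnKC mn); apply: le_trans (LDS_prob_submul _ _ q0 _) _.
by rewrite exprS ler_wpM2l ?mallows_prob_ge0 ?IH // leq_subRL.
Qed.

(** * Greedy growth of a decreasing chain *)

Section ChainLower.
Variables (R : realType) (q : R).
Hypothesis q01 : 0 < q < 1.

Let q0 : 0 < q. Proof. by case/andP: q01. Qed.
Let q1 : q < 1. Proof. by case/andP: q01. Qed.

Lemma qnum_le n : (1 - q) * qnum q n <= 1.
Proof. by rewrite qnumE lerBlDr lerDl exprn_ge0 ?ltW. Qed.

Lemma window_sum n H w : (H + w <= n)%N ->
  w%:R * q ^+ (H + w) <= \sum_(r < n | (H <= r < H + w)%N) q ^+ r.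
Proof.
move=> le; under eq_bigl do rewrite andbC.
rewrite -(big_geq_mkord H n (fun r => (r < H + w)%N) (fun r => q ^+ r)).
rewrite -(big_nat_widen _ _ _ xpredT) //.
apply: le_trans (_ : \sum_(H <= r < H + w) q ^+ (H + w) <= _).
  by rewrite sumr_const_nat addKn mulr_natl.
apply: ler_sum_nat => r /andP[_ lt].
by apply: ler_wiXn2l; [exact: ltW|exact: ltW|exact: ltnW].
Qed.

Lemma mallows_prob_lift n (E : pred 'S_n) (E' : pred 'S_n.+1) :
  (forall s r, E s -> E' (lift_perm ord0 r s)) ->
  mallows_prob n q E <= mallows_prob n.+1 q E'.
Proof.
move=> EE; rewrite mallows_prob_rec // ler_pdivlMr ?qnum_gt0 // mulrC.
rewrite /qnum mulr_suml; apply: ler_sum => r _.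
by rewrite ler_wpM2l ?exprn_ge0 ?(ltW q0) // mallows_prob_mono // => s; apply: EE.
Qed.

(** Since [qnum q n.+1] is at most [1 / (1 - q)], the new first value falls in the window with
    probability at least [d]. Given a value in the window, [E'] is at least as likely as [F]; given
    any other, at least as likely as [E]. *)
Lemma mallows_prob_window n (E F : pred 'S_n) (E' : pred 'S_n.+1) H w d :
  (forall s r, E s -> E' (lift_perm ord0 r s)) ->
  (forall s (r : 'I_n.+1), F s -> (H <= r < H + w)%N -> E' (lift_perm ord0 r s)) ->
  (H + w <= n.+1)%N -> d <= w%:R * q ^+ (H + w) * (1 - q) ->
  mallows_prob n q E <= mallows_prob n q F ->
  mallows_prob n q E + d * (mallows_prob n q F - mallows_prob n q E)
    <= mallows_prob n.+1 q E'.
Proof.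
move=> EE FE le dle; set x := mallows_prob n q E; set y := mallows_prob n q F => xy.
rewrite mallows_prob_rec // ler_pdivlMr ?qnum_gt0 //.
apply: le_trans (_ : \sum_(r < n.+1) q ^+ r * x +
   \sum_(r < n.+1 | (H <= r < H + w)%N) q ^+ r * (y - x) <= _); last first.
  rewrite [X in _ + X]big_mkcond -big_split; apply: ler_sum => r _ /=.
  case: ifP => win; last first.
    rewrite addr0 ler_wpM2l ?exprn_ge0 ?(ltW q0) // mallows_prob_mono // => s.
    exact: EE.
  rewrite -mulrDr addrC subrK ler_wpM2l ?exprn_ge0 ?(ltW q0) //.
  by rewrite mallows_prob_mono // => s Fs; apply: FE.
rewrite mulrDl -mulr_suml -/(qnum q n.+1) mulrC lerD2l -mulr_suml mulrAC.
rewrite ler_wpM2r ?subr_ge0 //; apply: le_trans (window_sum le).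
have Q0 := qnum_gt0 q0 n.
apply: le_trans (_ : w%:R * q ^+ (H + w) * (1 - q) * qnum q n.+1 <= _).
  by rewrite ler_wpM2r // ltW.
by rewrite -mulrA ler_piMr ?qnum_le // mulr_ge0 ?exprn_ge0 ?(ltW q0).
Qed.

(** While [b] values are prepended the threshold [h + i] rises with [i], and at each step the window
    of [w] values just above it gives a new chance of at least [d] to extend the chain. Iterating
    [x + d * (y - x)] from 0 yields [y * (1 - (1 - d) ^+ b)]. *)
Lemma chain_chunk n k h b w d : 0 <= d <= 1 -> (h + w <= n.+1)%N ->
  d <= w%:R * q ^+ (h + b + w) * (1 - q) ->
  mallows_prob n q (fun s => chain s k h) * (1 - (1 - d) ^+ b) <=
  mallows_prob (n + b) q (fun s => chain s k.+1 (h + b + w)).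
Proof.
move=> /andP[d0 d1] hw dle; set y := mallows_prob n q _.
have y0 : 0 <= y by apply: mallows_prob_ge0.
have yle i : y <= mallows_prob (n + i) q (fun s => chain s k (h + i)).
  elim: i => [|i IH]; first by rewrite /y !addn0.
  apply: le_trans IH _; rewrite !addnS; apply: mallows_prob_lift => s r.
  exact: chain_lift.
suff: forall i, (i <= b)%N -> y * (1 - (1 - d) ^+ i) <=
    mallows_prob (n + i) q (fun s => chain s k.+1 (h + i + w)) by apply.
elim=> [_|i IH ib]; first by rewrite expr0 subrr mulr0 mallows_prob_ge0.
have {}IH := IH (ltnW ib); set x := mallows_prob _ q _ in IH.
have d'0 : 0 <= 1 - d by rewrite subr_ge0.
have yl := yle i; set y' := mallows_prob _ _ _ in yl.
rewrite (addnS n) (addnS h) addSn.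
have up (s : 'S_(n + i)) r : chain s k.+1 (h + i + w) ->
  chain (lift_perm ord0 r s) k.+1 (h + i + w).+1 by apply: chain_lift.
(* [mallows_prob_window] needs [x <= y']; if [x] has already passed [y], the claim is immediate. *)
have [yx|xy] := leP y x.
  apply: le_trans (mallows_prob_lift up); rewrite -/x; apply: le_trans yx.
  by rewrite ler_piMr // lerBlDr lerDl exprn_ge0.
have := @mallows_prob_window (n + i) (fun s => chain s k.+1 (h + i + w))
   (fun s => chain s k (h + i)) (fun s => chain s k.+1 (h + i + w).+1) (h + i) w d up.
rewrite -/x -/y' => step.
apply: le_trans (step _ _ _ _); last by apply: ltW; apply: lt_le_trans yl.
- apply: le_trans (_ : x + d * (y - x) <= _); last first.
    by rewrite lerD2l ler_wpM2l // lerD2r.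
  rewrite exprS.
  apply: le_trans (_ : (1 - d) * (y * (1 - (1 - d) ^+ i)) + d * y <= _).
    by rewrite le_eqVlt; apply/orP; left; apply/eqP; ring.
  apply: le_trans (_ : (1 - d) * x + d * y <= _); first by rewrite lerD2r ler_wpM2l.
  by rewrite le_eqVlt; apply/orP; left; apply/eqP; ring.
- move=> s r cs /andP[hr rw]; apply: chain_weaken (chain_cons cs hr).
  by rewrite ltnS ltnW.
- by lia.
- apply: le_trans dle _; rewrite ler_wpM2r ?subr_ge0 ?(ltW q1) // ler_wpM2l //.
  by apply: ler_wiXn2l; [exact: ltW|exact: ltW|]; lia.
Qed.

(** Bernoulli's inequality for [(1 + d) ^+ b], then [(1 - d) ^+ b * (1 + d) ^+ b <= 1]. *)
Lemma bernoulli_inv (d : R) b : 0 <= d <= 1 -> (1 - d) ^+ b * (1 + b%:R * d) <= 1.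
Proof.
move=> /andP[d0 d1].
apply: le_trans (_ : (1 - d) ^+ b * (1 + d) ^+ b <= _).
  rewrite ler_wpM2l ?exprn_ge0 ?subr_ge0 //.
  elim: b => [|b IH]; first by rewrite expr0 mul0r addr0.
  rewrite exprS; apply: le_trans (_ : (1 + d) * (1 + b%:R * d) <= _).
    by rewrite -natr1; have : 0 <= b%:R :> R by []; nra.
  by rewrite ler_wpM2l // addr_ge0.
by rewrite -exprMn exprn_ile1 //; nra.
Qed.

(** With [u = b%:R * d <= 1], [bernoulli_inv] gives at least [u / (1 + u) >= u / 2]. *)
Lemma one_sub_expr_ge (d : R) b : 0 <= d <= 1 -> b%:R * d <= 1 ->
  b%:R * d / 2 <= 1 - (1 - d) ^+ b.
Proof.
move=> /andP[d0 d1] bd1.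
have le := bernoulli_inv b (introT andP (conj d0 d1)).
have : 0 <= (1 - d) ^+ b by rewrite exprn_ge0 ?subr_ge0.
have : 0 <= b%:R * d by rewrite mulr_ge0.
move: le bd1; set u := _ * d; set v := _ ^+ _; nra.
Qed.

Lemma LDS_prob_ge L b d : 0 <= d -> b%:R * d <= 1 -> (0 < b)%N ->
  d <= b%:R * q ^+ (2 * L * b) * (1 - q) ->
  (b%:R * d / 2) ^+ L <= mallows_prob (2 * L * b) q (fun s => (L <= LDS s)%N).
Proof.
move=> d0 bd1 b0 dle.
have d1 : d <= 1 by apply: le_trans bd1; rewrite ler_peMl // ler1n.
(* One round adds [b] entries but raises the threshold by [b + b], once for the shift and once for
   the window; the [L * b] initial entries make room for the last windows. *)
suff H j : (j <= L)%N -> (b%:R * d / 2) ^+ j <=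
    mallows_prob (L * b + j * b) q (fun s => chain s j (j * (b + b))).
  have := H L (leqnn L); rewrite -mulnDl addnn -mul2n => /le_trans; apply.
  by apply: mallows_prob_mono => // s; apply: chain_LDS.
elim: j => [_|j IH jL].
  rewrite expr0 mallows_probT // => s; apply/chainP; exists set0.
  by split; rewrite ?cards0 //; [apply/decr_onP => i j|move=> i]; rewrite inE.
rewrite exprSr.
apply: le_trans (_ : mallows_prob (L * b + j * b) q (fun s => chain s j (j * (b + b)))
   * (1 - (1 - d) ^+ b) <= _).
  apply: ler_pM; rewrite ?exprn_ge0 ?mulr_ge0 ?invr_ge0 //; first exact/IH/ltnW.
  by apply: one_sub_expr_ge; rewrite ?d0.
have jb : (j.+1 * b <= L * b)%N by rewrite leq_mul2r jL orbT.
have := @chain_chunk (L * b + j * b) j (j * (b + b)) b b d.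
rewrite -addnA -mulSnr -addnA -mulSnr; apply; first by rewrite d0.
  by rewrite mulSn in jb; lia.
apply: le_trans dle _; rewrite ler_wpM2r ?subr_ge0 ?(ltW q1) // ler_wpM2l //.
by apply: ler_wiXn2l; [exact: ltW|exact: ltW|]; nia.
Qed.

End ChainLower.

(** * Erdos-Szekeres: without long decreasing subsequences there is a large increasing set *)

Definition incr_on n (s : 'S_n) (A : {set 'I_n}) : bool :=
  [forall i in A, forall j in A, (i < j)%N ==> (s i < s j)%N].

Lemma incr_onP n (s : 'S_n) (A : {set 'I_n}) :
  reflect {in A &, forall i j : 'I_n, (i < j)%N -> (s i < s j)%N} (incr_on s A).
Proof.
apply: (iffP forall_inP) => [H i j iA jA|H i iA].
  by have /forall_inP/(_ j jA)/implyP := H i iA.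
by apply/forall_inP => j jA; apply/implyP; apply: H.
Qed.

Section ErdosSzekeres.
Variables (n : nat) (s : 'S_n).

Definition ends_at (i : 'I_n) : pred {set 'I_n} :=
  [pred A | [&& decr_on s A, i \in A & [forall j in A, (j <= i)%N]]].

Definition height (i : 'I_n) : nat := \max_(A | ends_at i A) #|A|.

Lemma height_witness i : exists2 A, ends_at i A & #|A| = height i.
Proof.
have [|A dA e] := @eq_bigmax_cond _ (ends_at i) (fun A : {set 'I_n} => #|A|).
  apply/card_gt0P; exists [set i]; rewrite !inE eqxx /=; apply/andP; split.
    by apply/decr_onP => j k /set1P-> /set1P->; rewrite ltnn.
  by apply/forall_inP => j /set1P->.
by exists A; rewrite ?/height ?e.
Qed.

Lemma height_le i : (height i <= LDS s)%N.
Proof. by have [A /and3P[dA _ _] <-] := height_witness i; apply: leq_LDS. Qed.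

(** If [s j < s i], a longest decreasing set ending at [i] could be continued by [j], which would
    make [height j] larger. *)
Lemma height_incr (i j : 'I_n) : height i = height j -> (i < j)%N -> (s i < s j)%N.
Proof.
move=> e ij; case: ltngtP => // [ji|/val_inj/perm_inj eij]; last first.
  by move: ij; rewrite eij ltnn.
have [A /and3P[/decr_onP dA iA /forall_inP lA] cA] := height_witness i.
have jA : j \notin A by apply/negP => /lA; rewrite leqNgt ij.
have : (#|j |: A| <= height j)%N.
  apply: (@leq_bigmax_cond _ (ends_at j) (fun A : {set 'I_n} => #|A|)).
  apply/and3P; split; [|exact: setU11|]; last first.
    apply/forall_inP => k /setU1P[->//|/lA ki].
    exact: leq_trans ki (ltnW ij).
  apply/decr_onP => a b /setU1P[->|aA] /setU1P[->|bA]; rewrite ?ltnn //; last exact: dA.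
    by move=> jb; have := lA _ bA; rewrite leqNgt (ltn_trans ij jb).
  move=> _; have := lA _ aA; rewrite leq_eqVlt => /orP[/eqP/val_inj->//|ai].
  by apply: ltn_trans ji _; apply: dA.
by rewrite cardsU1 jA cA e ltnn.
Qed.

(** The heights colour the positions with [L] colours and each colour class is increasing, so the
    pigeonhole principle applies. *)
Lemma incr_of_LDS L : (LDS s < L)%N -> exists2 A, incr_on s A & (n <= L * #|A|)%N.
Proof.
move=> lt; have hL i : (height i < L)%N by apply: leq_ltn_trans (height_le i) lt.
pose c i := Ordinal (hL i); pose B k := [set i | c i == k].
have L0 : (0 < L)%N by apply: leq_ltn_trans lt.
have inc k : incr_on s (B k).
  apply/incr_onP => i j; rewrite !inE => /eqP ci /eqP cj; apply: height_incr.
  by have := congr1 val (etrans ci (esym cj)).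
have tot : n = (\sum_(k < L) #|B k|)%N.
  rewrite -[LHS]card_ord -sum1_card (partition_big c xpredT) //=.
  by apply: eq_bigr => k _; rewrite -sum1_card; apply: eq_bigl => i; rewrite inE.
case: (boolP [exists k, (n <= L * #|B k|)%N]) => [/existsP[k le]|].
  by exists (B k).
rewrite negb_exists => /forallP all.
have n0 : (0 < n)%N by have := all (Ordinal L0); rewrite -ltnNge; lia.
have : (L * n <= L * n.-1)%N.
  rewrite {1}tot big_distrr /= -[X in (_ <= X * _)%N]card_ord -sum_nat_const.
  by apply: leq_sum => k _; rewrite -ltnS prednK // ltnNge all.
by rewrite leq_pmul2l //; lia.
Qed.

End ErdosSzekeres.

(** * The probability that given positions are increasing *)

Lemma inv_count_perm_on n (I : {set 'I_n}) (r p : 'S_n) : perm_on I r ->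
  (inv_count (r * p)%g <= inv_count p + 2 * #|I| * n)%N.
Proof.
move=> rI; rewrite /inv_count.
set S := [set _ | _]; set T := [set _ | _].
(* Only pairs that meet [I] can change their status. *)
have sub : S \subset T :|: (setX I setT :|: setX setT I).
  apply/subsetP => -[i j]; rewrite !inE /= !permM andbT.
  case: (boolP (i \in I)) => iI; first by rewrite /= orbT.
  case: (boolP (j \in I)) => jI; first by rewrite /= !orbT.
  by rewrite !(out_perm rI) // => ->.
apply: leq_trans (subset_leq_card sub) _.
apply: leq_trans (leq_card_setU _ _) _; rewrite leq_add2l.
apply: leq_trans (leq_card_setU _ _) _; rewrite !cardsX !cardsT card_ord.
by rewrite [(n * _)%N]mulnC addnn -mul2n mulnA.
Qed.

(** At the smallest moved position [i], [r i < i] contradicts injectivity; if [r i > i], the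
    preimage of [i] is a later position of [I] with a smaller image. *)
Lemma incr_perm_on_id n (I : {set 'I_n}) (r : 'S_n) : perm_on I r ->
  {in I &, {homo r : i j / (i < j)%N}} -> r = 1%g.
Proof.
move=> rI mono; apply/permP => i; rewrite perm1.
move: {2}(nat_of_ord i) (leqnn i) => k; elim: k i => [|k IH] i ik.
all: apply/eqP; apply: contraT => ne.
all: have iI : i \in I by apply: contraR ne => /(out_perm rI)->.
all: have small (j : 'I_n) : (j < i)%N -> r j = j by [move=> ?; lia|move=> ?; apply: IH; lia].
all: have riI : r i \in I by rewrite (perm_closed _ rI).
all: case: (ltngtP (r i) i) => [lt|gt|/val_inj e]; last by rewrite e eqxx in ne.
all: try by have /perm_inj e := small _ lt; rewrite e eqxx in ne.
all: pose j := (r^-1)%g i; have rj : r j = i by rewrite permKV.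
all: have jI : j \in I by rewrite -(perm_closed _ rI) rj.
all: case: (ltngtP j i) => [lt|gt'|/val_inj e].
all: try by have := small _ lt; rewrite rj => e; rewrite e ltnn in lt.
all: try by have := mono _ _ iI jI gt'; rewrite rj; case: ltngtP gt.
all: by rewrite -e rj e eqxx in ne.
Qed.

Section IncrProb.
Variables (R : realType) (q : R).
Hypothesis q01 : 0 < q < 1.
Let q0 : 0 < q. Proof. by case/andP: q01. Qed.
Let q1 : q < 1. Proof. by case/andP: q01. Qed.

(* Rearranging the values on I in any of the #|I|! possible ways changes the
   number of inversions by at most [2 * #|I| * n]. *)
Lemma incr_prob_le n (I : {set 'I_n}) :
  (#|I|`!)%:R * q ^+ (2 * #|I| * n) * mallows_prob n q (fun s => incr_on s I) <= 1.
Proof.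
rewrite mallows_probE mulrA ler_pdivrMr ?mallows_Z_gt0 // mul1r.
pose D : {set 'S_n * 'S_n} := [set u | perm_on I u.1 && incr_on u.2 I].
pose f (u : 'S_n * 'S_n) := (u.1 * u.2)%g.
(* If [r * p = r' * p'], then [r'^-1 * r] is increasing on [I] because [p] and [p'] both are, so it
   is the identity. *)
have finj : {in D &, injective f}.
  move=> [r p] [r' p']; rewrite !inE /f /= => /andP[rI /incr_onP ip] /andP[rI' /incr_onP ip'] e.
  have e' : (r'^-1 * r)%g = 1%g.
    apply: (@incr_perm_on_id _ I); first by rewrite perm_onM // perm_onV.
    have tI : perm_on I (r'^-1 * r)%g by rewrite perm_onM // perm_onV.
    have ep : p' = (r'^-1 * r * p)%g by rewrite -mulgA e mulKg.
    move=> i j iI jI ij; have := ip' _ _ iI jI ij; rewrite ep !(permM _ p).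
    have /ip H : (r'^-1 * r)%g i \in I by rewrite (perm_closed _ tI).
    have /ip H' : (r'^-1 * r)%g j \in I by rewrite (perm_closed _ tI).
    case: (ltngtP ((r'^-1 * r)%g i) ((r'^-1 * r)%g j)) => // [gt|/val_inj/perm_inj eij].
      have : (p ((r'^-1 * r)%g j) < p ((r'^-1 * r)%g i))%N.
        by apply: ip => //; rewrite (perm_closed _ tI).
      by case: ltngtP.
    by move: ij; rewrite eij ltnn.
  have er : r = r' by apply/eqP; rewrite eq_sym eq_mulVg1 e'.
  by move: e; rewrite er => /mulgI->.
apply: le_trans (_ : \sum_(u in D) q ^+ inv_count (f u) <= _); last first.
  rewrite -(big_imset (fun s => q ^+ inv_count s) finj) /= /mallows_Z big_mkcond.
  by apply: ler_sum => s _; case: ifP => // _; apply/ltW/exprn_gt0.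
have -> : (#|I|`!)%:R = \sum_(r : 'S_n | perm_on I r) 1 :> R.
  by rewrite -card_perm (sumr_const (perm_on I)).
rewrite -mulrA mulr_suml.
rewrite (eq_bigl (fun u : 'S_n * 'S_n => perm_on I u.1 && incr_on u.2 I)); last first.
  by move=> u; rewrite inE.
rewrite -(pair_big (perm_on I) (fun s => incr_on s I)
  (fun r p => q ^+ inv_count (f (r, p)))) /=.
apply: ler_sum => r rI; rewrite mul1r mulr_sumr [leRHS]big_mkcond; apply: ler_sum => p _.
case: ifP => _; last by rewrite mul0r mulr0.
rewrite mul1r -exprD; apply: ler_wiXn2l; [exact: ltW|exact: ltW|].
by rewrite addnC /f /=; apply: inv_count_perm_on.
Qed.

(** Union bound over the sets of size [l], whose number is at most [n ^ l / l!]; this supplies the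
    second factorial. For [L > 0] the hypothesis says that [l] is at most [n / L] rounded up. *)
Lemma LDS_lt_prob_le n L l : (forall a, (n <= L * a)%N -> (l <= a)%N) ->
  (l`!)%:R ^+ 2 * q ^+ (2 * l * n) * mallows_prob n q (fun s => (LDS s < L)%N)
  <= n%:R ^+ l.
Proof.
move=> lP.
have le : mallows_prob n q (fun s => (LDS s < L)%N) <=
    \sum_(I : {set 'I_n} | #|I| == l) mallows_prob n q (fun s => incr_on s I).
  apply: mallows_prob_bigU => // s /incr_of_LDS[A /incr_onP iA /lP].
  case/exists_subset_card => B /subsetP BA cB; apply/hasP; exists B.
    exact: mem_index_enum.
  by rewrite cB eqxx; apply/incr_onP => i j /BA ? /BA ?; apply: iA.
have pos : 0 <= (l`!)%:R ^+ 2 * q ^+ (2 * l * n) by rewrite mulr_ge0 ?exprn_ge0 ?(ltW q0).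
apply: le_trans (ler_wpM2l pos le) _; rewrite mulr_sumr.
apply: le_trans (_ : \sum_(I : {set 'I_n} | #|I| == l) (l`!)%:R <= _).
  apply: ler_sum => I /eqP cI; have := incr_prob_le I; rewrite cI => H.
  by rewrite expr2 -2!mulrA ler_piMr // mulrA.
rewrite sumr_const -natrX -mulrnA ler_nat -[X in (_ * X <= _)%N]cardsE.
rewrite card_draws card_ord mulnC bin_ffact ffact_prod -[X in (_ ^ X)%N]card_ord.
by rewrite -prod_nat_const; apply: leq_prod => i _; apply: leq_subr.
Qed.

(** * The completely reversed block *)

Lemma inv_count_le n (s : 'S_n) : (inv_count s <= 'C(n, 2))%N.
Proof.
rewrite inv_countE exchange_big /= -bin2_sum big_mkord; apply: leq_sum => j _.
apply: leq_trans (_ : \sum_(i < n) (i < j) <= _)%N; last by rewrite sum_ltn_ord // ltnW.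
by apply: leq_sum => i _; case: (i < j)%N; case: (_ < _)%N.
Qed.

(** The normalization is a product of [n] factors [qnum], each at most [1 / (1 - q)]. *)
Lemma mallows_Z_le n : (1 - q) ^+ n * mallows_Z n q <= 1.
Proof.
elim: n => [|n IH].
  rewrite expr0 mul1r /mallows_Z (eq_bigr (fun=> 1)); last first.
    by move=> s _; rewrite inv_countE big_ord0.
  by rewrite sumr_const card_Sn.
rewrite mallows_Z_rec // exprS mulrACA; apply: mulr_ile1 => //.
- by rewrite mulr_ge0 ?subr_ge0 ?(ltW q1) ?(ltW (qnum_gt0 q0 n)).
- by rewrite mulr_ge0 ?exprn_ge0 ?subr_ge0 ?(ltW q1) ?(ltW (mallows_Z_gt0 q0 n)).
- exact: qnum_le.
Qed.

Lemma LDS_prob_rev L :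
  q ^+ 'C(L, 2) * (1 - q) ^+ L <= mallows_prob L q (fun s => (L <= LDS s)%N).
Proof.
pose s := perm (@rev_ord_inj L).
have Ls : (L <= LDS s)%N.
  rewrite -[leqLHS]card_ord -cardsT; apply: leq_LDS; apply/decr_onP => i j _ _ ij.
  by rewrite !permE /=; have := ltn_ord j; lia.
rewrite /mallows_prob (bigD1 s) //= -[leLHS]addr0 lerD ?sumr_ge0 //; last first.
  by move=> p _; apply: mallows_ge0.
rewrite /mallows; apply: ler_pM; rewrite ?exprn_ge0 ?subr_ge0 ?(ltW q0) ?(ltW q1) //.
  by apply: ler_wiXn2l; [exact: ltW|exact: ltW|exact: inv_count_le].
by rewrite -div1r ler_pdivlMr ?mallows_Z_gt0 // mallows_Z_le.
Qed.

End IncrProb.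

(** * Numerical estimates and the explicit form of the bounds *)

Section Numerics.
Variable R : realType.
Implicit Types q p t d x : R.

(** Induction through [(1 + 1 / m) ^ m <= e]. *)
Lemma fact_lower n : n%:R ^+ n <= expR 1 ^+ n * (n`!)%:R :> R.
Proof.
elim: n => [|n IH]; first by rewrite !expr0 mul1r.
case: n IH => [_|n IH].
  by rewrite !expr1 mulr1; apply: le_trans (expR_ge1Dx 1); rewrite lerDl.
set m := n.+1 in IH *.
have m0 : 0 < m%:R :> R by rewrite ltr0n.
have le : m.+1%:R ^+ m <= m%:R ^+ m * expR 1 :> R.
  rewrite -[X in expR X](divff (lt0r_neq0 m0)) [_ / _]mulrC expRM_natr -exprMn.
  apply: lerXn2r; rewrite ?nnegrE ?mulr_ge0 ?expR_ge0 //.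
  apply: le_trans (ler_wpM2l (ltW m0) (expR_ge1Dx _)).
  by rewrite mulrDr mulr1 divff ?lt0r_neq0 // natr1.
rewrite exprS factS natrM [expR 1 ^+ _]exprSr.
rewrite (_ : _ * _ * (_ * _) = m.+1%:R * (expR 1 ^+ m * (m`!)%:R * expR 1)); last by ring.
rewrite ler_wpM2l //; apply: le_trans le _.
by rewrite ler_wpM2r ?expR_ge0.
Qed.

Lemma expr_q_lower q (k : nat) c : 1 / 2 <= q < 1 -> k%:R * (1 - q) <= c ->
  expR (- (2 * c)) <= q ^+ k.
Proof.
move=> /andP[qh q1] kc.
have le : expR (- (2 * (1 - q))) <= q.
  rewrite expRN -div1r ler_pdivrMr ?expR_gt0 //.
  (* That this product is at least 1 is where [1 / 2 <= q] enters. *)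
  apply: le_trans (_ : q * (1 + 2 * (1 - q)) <= _); first by nra.
  by rewrite ler_wpM2l ?expR_ge1Dx //; lra.
apply: le_trans (_ : expR (- (2 * (1 - q))) ^+ k <= _).
  by rewrite -expRM_natr ler_expR; lra.
by apply: lerXn2r; rewrite ?nnegrE ?expR_ge0 //; lra.
Qed.

(** By [bernoulli_inv], [1 - t ^+ i >= i * (1 - t) / (1 + i * (1 - t))], which is at least [i * x]
    for [i <= L]. *)
Lemma qpoch_lower t x L : 0 < t < 1 -> 0 <= x -> x * (1 + L%:R * (1 - t)) <= 1 - t ->
  (L`!)%:R * x ^+ L <= qpoch t L.
Proof.
move=> /andP[t0 t1] x0 xL.
have F i : (i < L)%N -> i.+1%:R * x <= 1 - t ^+ i.+1.
  move=> iL; have d01 : 0 <= 1 - t <= 1 by apply/andP; split; lra.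
  have := bernoulli_inv i.+1 d01; rewrite subKr.
  have iL' : i.+1%:R <= L%:R :> R by rewrite ler_nat.
  have i0 : 0 <= i.+1%:R :> R by [].
  have v0 : 0 <= t ^+ i.+1 by rewrite exprn_ge0 // ltW.
  move: iL' i0 v0; set a := i.+1%:R; set v := t ^+ _ => aL a0 v0 bv.
  have xa : x * (1 + a * (1 - t)) <= 1 - t.
    apply: le_trans xL; rewrite ler_wpM2l // lerD2l ler_wpM2r //; lra.
  have D0 : 0 < 1 + a * (1 - t) by nra.
  rewrite -(ler_pM2r D0).
  apply: le_trans (_ : a * (1 - t) <= _); last by lra.
  by rewrite -mulrA ler_wpM2l.
rewrite /qpoch; elim: L {xL} F => [|L IH] F; first by rewrite big_ord0 mulr1.
rewrite big_ord_recr /= factS natrM exprSr.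
rewrite (_ : _ * _ * (_ * _) = (L`!)%:R * x ^+ L * (L.+1%:R * x)); last by ring.
apply: ler_pM; rewrite ?mulr_ge0 ?exprn_ge0 //; last exact: F.
by apply: IH => i iL; apply: F; apply: ltnW.
Qed.

(** [qpoch_lower] and [fact_lower] give [qpoch t L >= (L * x / e) ^ L], and [chain_coef_le] has its
    square in the denominator. The free parameter [x] is fixed later according to the range of [L]
    and [q]. *)
Lemma LDS_prob_le_num n q x L : 0 < q < 1 -> 0 < x -> (0 < L)%N ->
  x * (1 + L%:R * (1 - Num.sqrt q)) <= 1 - Num.sqrt q ->
  mallows_prob n q (fun s => (L <= LDS s)%N) <=
  n%:R * ((1 - q) * expR 2 / (L%:R * x) ^+ 2) ^+ L * q ^+ 'C(L, 2).
Proof.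
move=> /andP[q0 q1] x0 L0 xL; set t := Num.sqrt q in xL *.
have t01 : 0 < t < 1.
  by rewrite sqrtr_gt0 q0 /= -[ltRHS]sqrtr1 ltr_sqrt.
have qE : q = t ^+ 2 by rewrite sqr_sqrtr // ltW.
have Lr : 0 < L%:R :> R by rewrite ltr0n.
have Q := qpoch_lower t01 (ltW x0) xL.
case: L L0 Lr xL Q => // k _ Lr xL Q.
apply: le_trans (LDS_prob_le t01 qE n k) _; rewrite -mulrA ler_wpM2l //.
apply: le_trans (chain_coef_le t01 qE k) _.
rewrite mulrAC ler_wpM2r ?exprn_ge0 ?(ltW q0) //.
rewrite -[_ * expR 2 / _]mulrA exprMn ler_wpM2l ?exprn_ge0 ?subr_ge0 ?(ltW q1) //.
rewrite expr_div_n -exprM mulnC exprM.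
have low : (k.+1%:R * x) ^+ k.+1 <= expR 1 ^+ k.+1 * qpoch t k.+1.
  apply: le_trans (_ : expR 1 ^+ k.+1 * ((k.+1)`!%:R * x ^+ k.+1) <= _).
    by rewrite mulrA exprMn ler_wpM2r ?fact_lower // exprn_ge0 // ltW.
  by rewrite ler_wpM2l // exprn_ge0 ?expR_ge0.
have A0 : 0 < (k.+1%:R * x) ^+ k.+1 by rewrite exprn_gt0 ?mulr_gt0.
have Q0 := qpoch_gt0 t01 k.+1.
rewrite -div1r ler_pdivrMr ?exprn_gt0 // mulrAC ler_pdivlMr ?(exprn_gt0 2 A0) // mul1r.
have -> : expR 2 = expR 1 ^+ 2 :> R by rewrite -expRM_natr mul1r.
rewrite [expR 1 ^+ 2 ^+ _]exprAC -exprMn.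
by apply: lerXn2r => //; rewrite nnegrE ?(ltW A0) // mulr_ge0 ?exprn_ge0 ?expR_ge0 ?(ltW Q0).
Qed.

(** 25 is the square of the 5 in [LDS_tail_small_L]. In [LDS_lt_block_prob], [expR 10] is [expR 2]
    from two factorials times [expR 8] from the power of [q]. *)
Definition upper_const : R := 25 * expR 10.
(** In [LDS_block_prob_ge], [expR (- 4)] bounds a power of [q]; 8 is 2 from [one_sub_expr_ge] times
    4 from rounding [b] down, since [b] enters squared. *)
Definition lower_const : R := expR (- 4) / 8.

Lemma sqrt_bounds q : 0 < q < 1 ->
  0 < 1 - Num.sqrt q /\ (1 - q) / 2 <= 1 - Num.sqrt q.
Proof.
move=> /andP[q0 q1]; have := sqr_sqrtr (ltW q0).
have : Num.sqrt q < 1 by rewrite -[ltRHS]sqrtr1 ltr_sqrt.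
have := sqrtr_ge0 q; move: (Num.sqrt q) => t t0 t1 e.
by split; [lra|nra].
Qed.

Lemma upper_const_ge0 : 0 <= upper_const.
Proof. by rewrite mulr_ge0 ?expR_ge0. Qed.

Lemma expR2_le_upper_const : 25 * expR 2 <= upper_const.
Proof. by rewrite /upper_const ler_wpM2l // ler_expR; lra. Qed.

Lemma LDS_tail_small_L n q L : 0 < q < 1 -> (0 < L)%N -> L%:R <= 3 / (1 - q) ->
  mallows_prob n q (fun s => (L <= LDS s)%N) <=
  n%:R * (upper_const / ((1 - q) * L%:R ^+ 2)) ^+ L.
Proof.
move=> q01 L0 Lq; have [d0 d1] := sqrt_bounds q01; have [q0 q1] := andP q01.
have p0 : 0 < 1 - q by rewrite subr_gt0.
have Lr : 0 < L%:R :> R by rewrite ltr0n.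
have Lp : L%:R * (1 - q) <= 3 by rewrite -ler_pdivlMr.
(* Writing [t] for the root of [q], [1 - q <= 2 * (1 - t)] and [L * (1 - q) <= 3]; the 5 is their
   [2 + 3]. *)
apply: le_trans (@LDS_prob_le_num n q ((1 - q) / 5) L q01 _ L0 _) _; first lra.
  by nra.
rewrite -mulrA ler_wpM2l //.
apply: le_trans (_ : ((1 - q) * expR 2 / (L%:R * ((1 - q) / 5)) ^+ 2) ^+ L <= _).
  rewrite ler_piMr ?exprn_ile1 ?(ltW q0) ?(ltW q1) // exprn_ge0 //.
  by apply: divr_ge0 (sqr_ge0 _); rewrite mulr_ge0 ?expR_ge0 ?(ltW p0).
apply: lerXn2r; rewrite ?nnegrE.
- by apply: divr_ge0 (sqr_ge0 _); rewrite mulr_ge0 ?expR_ge0 ?(ltW p0).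
- by apply: divr_ge0; rewrite mulr_ge0 ?expR_ge0 ?sqr_ge0 ?(ltW p0).
rewrite (_ : _ / _ = 25 * expR 2 / ((1 - q) * L%:R ^+ 2)); last first.
  by field; rewrite !gt_eqF.
by rewrite ler_wpM2r ?expR2_le_upper_const // invr_ge0 mulr_ge0 ?exprn_ge0 ?(ltW p0).
Qed.

Lemma LDS_tail_large_L n q L : 0 < q < 1 -> (0 < L)%N -> 3 / (1 - q) < L%:R ->
  mallows_prob n q (fun s => (L <= LDS s)%N) <=
  n%:R * ((upper_const * (1 - q)) ^+ L * q ^+ 'C(L, 2)).
Proof.
move=> q01 L0 Lq; have [d0 d1] := sqrt_bounds q01; have [q0 q1] := andP q01.
have p0 : 0 < 1 - q by rewrite subr_gt0.
have Lr : 0 < L%:R :> R by rewrite ltr0n.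
have Lp : 3 < L%:R * (1 - q) by rewrite -ltr_pdivrMr.
(* This [x] is admissible once [L * (1 - t) >= 1], with [t] the root of [q]; here it exceeds
   [3 / 2]. *)
apply: le_trans (@LDS_prob_le_num n q (1 / (2 * L%:R)) L q01 _ L0 _) _.
- by rewrite divr_gt0 ?mulr_gt0.
- by rewrite mulrC mulrA mulr1 ler_pdivrMr ?mulr_gt0 //; nra.
rewrite -mulrA ler_wpM2l // ler_wpM2r ?exprn_ge0 ?(ltW q0) //.
rewrite (_ : _ / _ ^+ 2 = 4 * expR 2 * (1 - q)); last by field; rewrite gt_eqF.
apply: lerXn2r; rewrite ?nnegrE ?mulr_ge0 ?expR_ge0 ?(ltW p0) //.
rewrite ler_wpM2r ?(ltW p0) //; apply: le_trans expR2_le_upper_const.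
by rewrite ler_wpM2r ?expR_ge0 // ler_nat.
Qed.

Lemma LDS_tail_small_q n q L : 0 < q < 1 -> q < 1 / 2 -> (2 <= L)%N ->
  mallows_prob n q (fun s => (L <= LDS s)%N) <= n%:R * upper_const ^+ L * q ^+ 'C(L, 2).
Proof.
move=> q01 qh L2; have [d0 d1] := sqrt_bounds q01; have [q0 q1] := andP q01.
have p0 : 0 < 1 - q by rewrite subr_gt0.
have L0 : (0 < L)%N by apply: leq_trans L2.
have Lr : 2 <= L%:R :> R by rewrite ler_nat.
have Lr0 : 0 < L%:R :> R by rewrite ltr0n.
(* Here only [L * (1 - t) >= 1 / 2] is available, hence the smaller [x]. *)
apply: le_trans (@LDS_prob_le_num n q (1 / (4 * L%:R)) L q01 _ L0 _) _.
- by rewrite divr_gt0 ?mulr_gt0.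
- by rewrite mulrC mulrA mulr1 ler_pdivrMr ?mulr_gt0 //; nra.
rewrite -mulrA -[leRHS]mulrA ler_wpM2l // ler_wpM2r ?exprn_ge0 ?(ltW q0) //.
rewrite (_ : _ / _ ^+ 2 = 16 * expR 2 * (1 - q)); last by field; rewrite gt_eqF.
apply: lerXn2r; rewrite ?nnegrE ?mulr_ge0 ?expR_ge0 ?(ltW p0) //.
apply: le_trans expR2_le_upper_const.
have := expR_ge0 (2 : R); nra.
Qed.

Lemma LDS_block_prob_ge q L : 1 / 2 <= q < 1 -> (0 < L)%N ->
  L%:R * (1 - q) <= 1 -> 1 <= (1 - q) * L%:R ^+ 2 ->
  exists2 m : nat, m%:R <= 2 / (1 - q) &
    (lower_const / ((1 - q) * L%:R ^+ 2)) ^+ L <= mallows_prob m q (fun s => (L <= LDS s)%N).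
Proof.
move=> qh L0 Lp1 Lp2; have [q2 q1] := andP qh.
have q01 : 0 < q < 1 by apply/andP; split; lra.
set p := 1 - q in Lp1 Lp2 *; have p0 : 0 < p by rewrite subr_gt0.
have Lr : 0 < L%:R :> R by rewrite ltr0n.
have Lp0 : 0 < L%:R * p by rewrite mulr_gt0.
pose b := Num.truncn (1 / (L%:R * p)).
have /andP[b1 b2] : b%:R <= 1 / (L%:R * p) < b.+1%:R.
  by apply: truncn_itv; rewrite divr_ge0 ?(ltW Lp0).
have b0 : (0 < b)%N by rewrite truncn_gt0 ler_pdivlMr // mul1r.
have br : 1 <= b%:R :> R by rewrite ler1n.
move: b1; rewrite ler_pdivlMr // => b1.
move: b2; rewrite ltr_pdivrMr // -natr1 => b2.
(* Rounding down a number that is at least 1 loses at most a factor 2. *)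
have b3 : 1 <= 2 * b%:R * (L%:R * p) by nra.
(* Follows from [(b * L * p) ^ 2 <= 1] and [p * L ^ 2 >= 1]; it ensures [b * d <= 1] below. *)
have b4 : p * b%:R ^+ 2 <= 1.
  have H : (b%:R * (L%:R * p)) ^+ 2 <= 1 by rewrite exprn_ile1 // mulr_ge0 ?(ltW Lp0).
  have : p * b%:R ^+ 2 * (p * L%:R ^+ 2) <= 1.
    by rewrite (_ : _ * _ = (b%:R * (L%:R * p)) ^+ 2) //; ring.
  by apply: le_trans; rewrite ler_peMr // mulr_ge0 ?sqr_ge0 ?(ltW p0).
exists (2 * L * b)%N.
  rewrite !natrM ler_pdivlMr // -/p.
  by rewrite (_ : _ * _ = 2 * (b%:R * (L%:R * p))); [lra|ring].
have e0 := expR_gt0 (- 4 : R).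
have e1 : expR (- 4) <= 1 :> R by rewrite -[leRHS]expR0 ler_expR; lra.
pose d := expR (- 4) * (p * b%:R).
have pb0 : 0 < p * b%:R by rewrite mulr_gt0 // ltr0n.
apply: le_trans (_ : (b%:R * d / 2) ^+ L <= _).
  apply: lerXn2r; rewrite ?nnegrE.
  - by rewrite !divr_ge0 ?mulr_ge0 ?sqr_ge0 ?(ltW e0) ?(ltW p0).
  - by rewrite divr_ge0 // mulr_ge0 // mulr_ge0 ?(ltW e0) ?(ltW pb0).
  rewrite ler_pdivrMr ?mulr_gt0 ?exprn_gt0 // /lower_const.
  rewrite (_ : _ / 2 * _ = expR (- 4) / 8 * (2 * b%:R * (L%:R * p)) ^+ 2).
    by rewrite ler_peMr ?divr_ge0 ?(ltW e0) // exprn_ege1.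
  by rewrite /d; field.
apply: LDS_prob_ge => //.
- by rewrite mulr_ge0 ?(ltW e0) ?(ltW pb0).
- rewrite (_ : _ * d = expR (- 4) * (p * b%:R ^+ 2)); last by rewrite /d; ring.
  by rewrite mulr_ile1 ?(ltW e0) // mulr_ge0 ?sqr_ge0 ?(ltW p0).
rewrite /d -/p (_ : _ * _ * p = q ^+ (2 * L * b) * (p * b%:R)); last by ring.
rewrite ler_wpM2r ?(ltW pb0) // (_ : -4 = - (2 * 2)); last by ring.
apply: expr_q_lower => //; rewrite -/p !natrM.
by rewrite (_ : _ * p = 2 * (b%:R * (L%:R * p))); [lra|ring].
Qed.

(** For [LDS < L] all [k] disjoint blocks have to fail, and they do so independently. *)
Lemma LDS_lower_of_block n q (m k L : nat) (a : R) : 0 < q < 1 -> (k * m <= n)%N ->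
  a <= mallows_prob m q (fun s => (L <= LDS s)%N) ->
  1 - (1 - a) ^+ k <= mallows_prob n q (fun s => (L <= LDS s)%N).
Proof.
move=> /andP[q0 q1] km am.
have C j : mallows_prob j q (fun s => (LDS s < L)%N) =
    1 - mallows_prob j q (fun s => (L <= LDS s)%N).
  rewrite -mallows_probC //; apply: eq_bigl => s /=; exact: ltnNge.
rewrite lerBlDr -lerBlDl -C; apply: le_trans (LDS_prob_pow L q0 km) _.
by apply: lerXn2r; rewrite ?nnegrE ?mallows_prob_ge0 ?C ?lerD2l ?lerN2 // subr_ge0
  (le_trans am) ?mallows_prob_le1.
Qed.

Lemma LDS_lower_moderate_L q (n L : nat) : 0 < q < 1 ->
  upper_const / Num.sqrt (1 - q) <= L%:R <= 1 / (1 - q) -> 1 / 2 <= q <= 1 - 4 / n%:R ->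
  1 - (1 - (lower_const / ((1 - q) * L%:R ^+ 2)) ^+ L) ^+ Num.truncn (n%:R * (1 - q) / 4)
  <= mallows_prob n q (fun s => (L <= LDS s)%N).
Proof.
move=> q01 /andP[CL Lp] /andP[q2 qn]; have [q0 q1] := andP q01.
have p0 : 0 < 1 - q by rewrite subr_gt0.
have s0 : 0 < Num.sqrt (1 - q) by rewrite sqrtr_gt0.
have C1 : 1 <= upper_const.
  have : 1 <= expR 10 :> R by apply: le_trans (expR_ge1Dx _); lra.
  rewrite /upper_const; lra.
have sL : 1 <= Num.sqrt (1 - q) * L%:R.
  by move: CL; rewrite ler_pdivrMr // mulrC => /(le_trans C1).
have L0 : (0 < L)%N.
  by rewrite lt0n; apply: contraTneq sL => ->; rewrite mulr0 -ltNge.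
have pL : 1 <= (1 - q) * L%:R ^+ 2.
  by rewrite -[1 - q](sqr_sqrtr (ltW p0)) -exprMn exprn_ege1.
have qh : 1 / 2 <= q < 1 by rewrite q2.
move: Lp; rewrite ler_pdivlMr // => Lp.
have [m mle am] := LDS_block_prob_ge qh L0 Lp pL.
apply: LDS_lower_of_block q01 _ am.
set k := Num.truncn _.
have kle : k%:R <= n%:R * (1 - q) / 4.
  by rewrite truncn_le divr_ge0 // mulr_ge0 ?(ltW p0).
rewrite -(ler_nat R) natrM.
(* The [k] blocks occupy at most half of the positions. *)
apply: le_trans (_ : (n%:R * (1 - q) / 4) * (2 / (1 - q)) <= _); first exact: ler_pM.
rewrite (_ : _ * (2 / _) = n%:R / 2); last by field; rewrite gt_eqF.
by rewrite ler_pdivrMr // ler_peMr // ler1n.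
Qed.

(** Here [n] is of order [1 / (1 - q)]: small enough for [q ^+ (2 * n) >= expR (- 8)], and large
    enough for [n <= 25 * (1 - q) * n ^ 2]. *)
Lemma LDS_lt_block_prob q (n N L : nat) : 1 / 2 <= q < 1 -> (0 < L)%N ->
  N%:R * (1 - q) <= 1 -> 1 / 2 <= N%:R * (1 - q) -> (N <= n < 2 * N)%N ->
  upper_const * (1 - q) * L%:R ^+ 2 <= 1 ->
  mallows_prob n q (fun s => (LDS s < L)%N) <=
  powR (upper_const * (1 - q) * L%:R ^+ 2) (n%:R / L%:R).
Proof.
move=> qh L0 Np1 Np2 /andP[Nn n2N] x1; have [q2 q1] := andP qh.
have q01 : 0 < q < 1 by apply/andP; split; lra.
set p := 1 - q in Np1 Np2 x1 *; have p0 : 0 < p by rewrite subr_gt0.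
have Lr : 0 < L%:R :> R by rewrite ltr0n.
have N0 : (0 < N)%N by rewrite lt0n; apply: contraTneq Np2 => ->; rewrite mul0r -ltNge; lra.
have n0 : (0 < n)%N by apply: leq_trans Nn.
have nr : 0 < n%:R :> R by rewrite ltr0n.
(* This is [n / L] rounded up. *)
pose l := ((n + L.-1) %/ L)%N.
have lP a : (n <= L * a)%N -> (l <= a)%N.
  move=> na; rewrite /l -ltnS ltn_divLR //; nia.
have nl : (n <= L * l)%N.
  by have := divn_eq (n + L.-1) L; have := ltn_pmod (n + L.-1) L0; rewrite -/l; nia.
have l0 : (0 < l)%N by rewrite lt0n; apply: contraTneq nl => ->; rewrite muln0; lia.
have lr : 0 < l%:R :> R by rewrite ltr0n.
have nlr : n%:R <= L%:R * l%:R :> R by rewrite -natrM ler_nat.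
have x0 : 0 < upper_const * p * L%:R ^+ 2.
  by rewrite !mulr_gt0 ?exprn_gt0 ?expR_gt0.
set x := upper_const * p * _ in x0 x1 *.
(* As [x <= 1] and [l >= n / L], the integer power is the smaller one. *)
apply: le_trans (_ : x ^+ l <= _); last first.
  rewrite -powR_mulrn ?(ltW x0) //; apply: ger_powR; first by rewrite x0.
  by rewrite ler_pdivrMr // mulrC.
set P := mallows_prob _ _ _.
have P0 : 0 <= P by apply: mallows_prob_ge0; lra.
have H := @LDS_lt_prob_le R q q01 n L l lP.
rewrite -/P in H.
have eq : expR (- 8) <= q ^+ (2 * n).
  rewrite (_ : -8 = - (2 * 4)); last by ring.
  apply: expr_q_lower => //; rewrite -/p natrM.
  have : n%:R <= 2 * N%:R :> R by rewrite -natrM ler_nat ltnW.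
  nra.
have F := fact_lower l.
have l2 : (l%:R ^+ 2) ^+ l * P <= (expR 10 * n%:R) ^+ l.
  have e8 : 0 < expR (- 8) ^+ l :> R by rewrite exprn_gt0 ?expR_gt0.
  rewrite -(ler_pM2l e8).
  apply: le_trans (_ : expR 1 ^+ l ^+ 2 * n%:R ^+ l <= _); last first.
    rewrite exprAC -!exprMn; apply: lerXn2r; rewrite ?nnegrE ?mulr_ge0 ?expR_ge0 //.
    rewrite mulrA -expRD -expRM_natr mul1r ler_wpM2r // ler_expR; lra.
  apply: le_trans (_ : expR 1 ^+ l ^+ 2 * ((l`!)%:R ^+ 2 * q ^+ (2 * l * n) * P) <= _);
    last by rewrite ler_wpM2l // !exprn_ge0 ?expR_ge0.
  rewrite (_ : expR 1 ^+ l ^+ 2 * _ = q ^+ (2 * l * n) * (expR 1 ^+ l * (l`!)%:R) ^+ 2 * P);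
    last by ring.
  rewrite mulrA ler_wpM2r //; apply: ler_pM.
  - exact: ltW.
  - by rewrite !exprn_ge0.
  - rewrite mulnAC exprM; apply: lerXn2r; rewrite ?nnegrE ?expR_ge0 //.
    by rewrite exprn_ge0; lra.
  - by rewrite exprAC; apply: lerXn2r; rewrite ?nnegrE ?mulr_ge0 ?exprn_ge0 ?expR_ge0.
have l2r : 0 < (l%:R ^+ 2) ^+ l :> R by rewrite !exprn_gt0.
rewrite -(ler_pM2l l2r); apply: le_trans l2 _; rewrite -exprMn.
apply: lerXn2r; rewrite ?nnegrE ?mulr_ge0 ?expR_ge0 ?sqr_ge0 ?(ltW p0) //.
have nN : N%:R <= n%:R :> R by rewrite ler_nat.
have np : 1 <= 2 * (n%:R * p) by nra.
have sq : n%:R ^+ 2 <= (L%:R * l%:R) ^+ 2 :> R.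
  by apply: lerXn2r; rewrite ?nnegrE ?mulr_ge0.
rewrite /x /upper_const.
rewrite (_ : l%:R ^+ 2 * _ = expR 10 * (25 * p * (L%:R * l%:R) ^+ 2)); last by ring.
rewrite ler_wpM2l ?expR_ge0 //.
apply: le_trans (_ : 25 * p * n%:R ^+ 2 <= _); last by rewrite ler_wpM2l // mulr_ge0 ?(ltW p0).
by nra.
Qed.

(** Blocks of length [N] are split off until fewer than [2 * N] positions remain. The last block
    absorbs the remainder, so the exponents add up to exactly [n / L]. *)
Lemma LDS_lt_prob_powR q (n L : nat) : 1 / 2 <= q <= 1 - 4 / n%:R -> (0 < n)%N ->
  (0 < L)%N ->
  mallows_prob n q (fun s => (LDS s < L)%N) <=
  powR (upper_const * (1 - q) * L%:R ^+ 2) (n%:R / L%:R).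
Proof.
move=> /andP[q2 qn] n0 L0.
have nr : 0 < n%:R :> R by rewrite ltr0n.
have n4 : 0 < 4 / n%:R :> R by rewrite divr_gt0.
have q1 : q < 1 by lra.
have q0 : 0 < q by lra.
have Lr : 0 < L%:R :> R by rewrite ltr0n.
have p0 : 0 < 1 - q by lra.
have np : 4 <= n%:R * (1 - q) by rewrite mulrC -ler_pdivrMr //; lra.
(* A base of at least 1 makes the right-hand side at least 1. *)
have [x1|x1] := leP 1 (upper_const * (1 - q) * L%:R ^+ 2).
  apply: le_trans (mallows_prob_le1 q0 _) _.
  rewrite -[leLHS](powRr0 (upper_const * (1 - q) * L%:R ^+ 2)).
  by apply: ler_powR => //; rewrite divr_ge0.
have x0 : 0 < upper_const * (1 - q) * L%:R ^+ 2 by rewrite !mulr_gt0 ?exprn_gt0 ?expR_gt0.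
pose N := Num.truncn (1 / (1 - q)).
have /andP[N1 N2] : N%:R <= 1 / (1 - q) < N.+1%:R.
  by apply: truncn_itv; rewrite divr_ge0 ?(ltW p0).
move: N1; rewrite ler_pdivlMr // => N1.
move: N2; rewrite ltr_pdivrMr // -natr1 => N2.
have N3 : 1 / 2 <= N%:R * (1 - q) by nra.
have N0 : (0 < N)%N by rewrite truncn_gt0 ler_pdivlMr //; lra.
have Nn : (N <= n)%N.
  by rewrite -(ler_nat R) -(ler_pM2r p0); lra.
have qh : 1 / 2 <= q < 1 by rewrite q2.
suff H k : (N <= k)%N -> mallows_prob k q (fun s => (LDS s < L)%N) <=
    powR (upper_const * (1 - q) * L%:R ^+ 2) (k%:R / L%:R) by apply: H.
elim/ltn_ind: k => k IH Nk.
have [kN|Nk2] := ltnP k (2 * N).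
  by apply: LDS_lt_block_prob N1 N3 _ (ltW x1); rewrite ?Nk.
rewrite -(subnKC Nk); apply: le_trans (LDS_prob_submul _ _ q0 _) _.
rewrite natrD mulrDl powRD; last by rewrite (gt_eqF x0) implybT.
apply: ler_pM; rewrite ?mallows_prob_ge0 //.
  apply: LDS_lt_block_prob N1 N3 _ (ltW x1) => //.
  by rewrite leqnn mul2n -addnn -[ltnLHS]addn0 ltn_add2l.
by apply: IH; rewrite ?ltn_subrL ?N0 ?(leq_trans N0 Nk) // leq_subRL // addnn -mul2n.
Qed.

End Numerics.

Theorem theorem1p7 :
  exists C c : Rdefinitions.R, 0 < C /\ 0 < c /\
  forall (n : nat) (q : Rdefinitions.R), (2 <= n)%N -> 0 < q < 1 ->
  (* (i) *)
  ((q < 1 - 2 / n%:R ->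
     forall L : nat, (2 <= L)%N ->
       mallows_prob n q (fun s => (L <= LDS s)%N) <=
       n%:R ^+ 8 *
       (if L%:R <= 3 / (1 - q)
        then (C / ((1 - q) * L%:R ^+ 2)) ^+ L
        else (C * (1 - q)) ^+ L * q ^+ ((L * (L - 1)) %/ 2)))
   /\
   (q < 1 / 2 ->
     forall L : nat, (2 <= L)%N ->
       mallows_prob n q (fun s => (L <= LDS s)%N) <=
       n%:R * C ^+ L * q ^+ ((L * (L - 1)) %/ 2))) /\
  (* (ii) *)
  ((forall L : nat,
      C / Num.sqrt (1 - q) <= L%:R <= 1 / (1 - q) ->
      1 / 2 <= q <= 1 - 4 / n%:R ->
      mallows_prob n q (fun s => (L <= LDS s)%N) >=
      1 - (1 - (c / ((1 - q) * L%:R ^+ 2)) ^+ L)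
            ^+ Num.truncn (n%:R * (1 - q) / 4))
   /\
   (forall L : nat, (2 <= L)%N ->
      mallows_prob n q (fun s => (L <= LDS s)%N) >=
      1 - (1 - q ^+ ((L * (L - 1)) %/ 2) * (1 - q) ^+ L) ^+ (n %/ L))) /\
  (* (iii) *)
  (1 / 2 <= q <= 1 - 4 / n%:R ->
     forall L : nat, (2 <= L)%N -> L%:R < c / Num.sqrt (1 - q) ->
       mallows_prob n q (fun s => (LDS s < L)%N) <=
       powR (C * (1 - q) * L%:R ^+ 2) (n%:R / L%:R)).
Proof.
exists (upper_const Rdefinitions.R), (lower_const Rdefinitions.R); split; first by rewrite mulr_gt0 ?expR_gt0.
split; first by rewrite divr_gt0 ?expR_gt0.
move=> n q n2 q01; have [q0 q1] := andP q01.
have p0 : 0 < 1 - q by rewrite subr_gt0.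
have n0 : (0 < n)%N by apply: leq_trans n2.
have nr : 0 < n%:R :> Rdefinitions.R by rewrite ltr0n.
have binE L : ((L * (L - 1)) %/ 2 = 'C(L, 2))%N by rewrite bin2 divn2 subn1.
split; first split.
- move=> _ L L2; rewrite binE; have L0 : (0 < L)%N by apply: leq_trans L2.
  (* The tail bounds carry a single factor [n], and [n <= n ^ 8]. *)
  have n8 (a : Rdefinitions.R) : 0 <= a -> n%:R * a <= n%:R ^+ 8 * a.
    move=> a0; rewrite ler_wpM2r // exprS ler_peMr ?(ltW nr) //.
    by rewrite exprn_ege1 // ler1n.
  have C0 := upper_const_ge0 Rdefinitions.R.
  case: (leP L%:R (3 / (1 - q))) => Lq.
    apply: le_trans (LDS_tail_small_L n q01 L0 Lq) _; apply: n8; rewrite exprn_ge0 //.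
    by rewrite divr_ge0 // mulr_ge0 ?sqr_ge0 ?(ltW p0).
  apply: le_trans (LDS_tail_large_L n q01 L0 Lq) _; apply: n8.
  by apply: mulr_ge0; apply: exprn_ge0; [exact: mulr_ge0 C0 (ltW p0)|exact: ltW].
- by move=> qh L L2; rewrite binE; apply: LDS_tail_small_q.
split; first split.
- by move=> L; apply: LDS_lower_moderate_L.
- move=> L L2; rewrite binE; apply: LDS_lower_of_block q01 _ (LDS_prob_rev q01 L).
  exact: leq_trunc_div.
- move=> qh L L2 _; apply: LDS_lt_prob_powR => //.
  exact: leq_trans L2.
Qed.
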